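(* Let $\tau\in\mathbf{C}$ lie in the fundamental region $-\frac12<\Re(\tau)\le\frac12$, $\Im(\tau)>0$, $|\tau|\ge 1$, and $\Re(\tau)\ge 0$ if $|\tau|=1$. Then for every $s\in\mathbf{C}$ with $\Re(s)>2$, $$\widetilde{E}_s(\tau)=\cos\left(\frac{\pi}{2}s\right)\frac{4}{\Gamma(s)}\int_0^\infty \lambda^{s-1}\left(e^{-i s\pi/2}\,e^{-\lambda}f_1(\tau,\lambda)+e^{i\tau\lambda}f_2(\tau,\lambda)\right)d\lambda,$$ where $$f_1(\tau,\lambda)=\frac{\cosh^2(\tau\lambda/2)}{1-2e^{-\lambda}\cosh(\tau\lambda)+e^{-2\lambda}},\qquad f_2(\tau,\lambda)=\frac{\cos^2(\lambda/2)}{1-2e^{i\tau\lambda}\cos(\lambda)+e^{2i\tau\lambda}}.$$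
   Context: For $\tau$ in the fundamental region, define $$\widetilde{E}_s(\tau)=\lim_{K\to\infty}\sum_{|m|,|n|\le K}\frac{1}{(m+n\tau)^s},$$ where $m,n$ range over integers and the term $m=n=0$ is omitted. For non-integer $s$ the power $\omega^s$ is taken on the branch cut along the negative lattice diagonal $\{-t(1+\tau):t>0\}$: $\omega^s=|\omega|^s e^{is\arg\omega}$ with $\theta\le\arg(\omega)\le\theta+2\pi$, where $\theta=\mathrm{Arg}(-1-\tau)\in(-\pi,-\pi/2)$. For lattice points on the cut ($\omega=-m-m\tau$, $m\ge1$), the two boundary values are averaged: $$\frac{1}{(-m-m\tau)^s}:=\frac{1}{2(m|1+\tau|)^s}\left(e^{-i\theta s}+e^{-i(\theta+2\pi)s}\right).$$ In the integral, $\lambda^{s-1}$ for $\lambda>0$ is the usual real-logarithm power. *)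

(* Defs.v *)
(* Over the real numbers of Stdlib; complex analysis follows Coquelicot. *)
From Stdlib Require Import Reals ZArith Lra Lia.
From Coquelicot Require Export Coquelicot.

Open Scope R_scope.

Definition Cexp (z : C) : C :=
  (exp (Re z) * cos (Im z), exp (Re z) * sin (Im z)).

Definition Ccos (z : C) : C := ((Cexp (Ci * z) + Cexp (- (Ci * z))) / 2)%C.

Definition Ccosh (z : C) : C := ((Cexp z + Cexp (- z)) / 2)%C.

(* Principal argument, with values in (-PI, PI] for z <> 0. *)
Definition Arg (z : C) : R :=
  if Rle_dec 0 (Im z) then acos (Re z / Cmod z) else - acos (Re z / Cmod z).

(* x ^ s for a real x > 0, with the real logarithm. *)
Definition Rcpow (x : R) (s : C) : C := Cexp (s * ln x)%C.

Definition CRInt_0_infty (f : R -> C) : C :=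
  RInt_gen (V := C_R_CompleteNormedModule) f (at_right 0) (Rbar_locally p_infty).

Definition ex_CRInt_0_infty (f : R -> C) : Prop :=
  ex_RInt_gen (V := C_R_NormedModule) f (at_right 0) (Rbar_locally p_infty).

(* Euler's integral; it is the Gamma function on the half plane Re s > 0. *)
Definition CGamma (s : C) : C :=
  CRInt_0_infty (fun t => Rcpow t (s - 1) * Cexp (- RtoC t))%C.

Definition fundamental_region (tau : C) : Prop :=
  - (1 / 2) < Re tau <= 1 / 2 /\ 0 < Im tau /\ 1 <= Cmod tau /\
  (Cmod tau = 1 -> 0 <= Re tau).

(* The argument of w in [theta, theta + 2 PI), for theta in (-PI, PI]. *)
Definition arg_from (theta : R) (w : C) : R :=
  if Rlt_dec (Arg w) theta then Arg w + 2 * PI else Arg w.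

(* w ^ s = |w| ^ s exp (i s arg w), on the branch of arg starting at theta. *)
Definition Cpow_from (theta : R) (w s : C) : C :=
  (Rcpow (Cmod w) s * Cexp (Ci * s * arg_from theta w))%C.

Definition theta_cut (tau : C) : R := Arg (- (1) - tau)%C.

(* The summand 1 / (m + n tau) ^ s.  On the branch cut, i.e. for m = n < 0, it
   is the average of the two boundary values.  The same formulas serve for
   integer s, where the branch is immaterial: see [lattice_term_nat]. *)
Definition lattice_term (tau s : C) (m n : Z) : C :=
  let theta := theta_cut tau in
  if (Z.eqb m 0 && Z.eqb n 0)%bool then 0%C
  else if (Z.eqb m n && Z.ltb m 0)%bool then
    (1 / (2 * Rcpow (IZR (- m) * Cmod (1 + tau)) s) *
     (Cexp (- (Ci * theta * s)) + Cexp (- (Ci * (theta + 2 * PI) * s))))%C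
  else (1 / Cpow_from theta (IZR m + IZR n * tau) s)%C.

(* The sum of f m n over |m| <= K, |n| <= K. *)
Definition square_sum (f : Z -> Z -> C) (K : nat) : C :=
  sum_n (fun i => sum_n (fun j =>
    f (Z.of_nat i - Z.of_nat K)%Z (Z.of_nat j - Z.of_nat K)%Z)
    (2 * K)) (2 * K).

Definition Etilde (tau s : C) : C :=
  lim (T := C_R_CompleteNormedModule)
    (filtermap (square_sum (lattice_term tau s)) eventually).

Definition f1 (tau : C) (lambda : R) : C :=
  (Ccosh (tau * lambda / 2) ^ 2 /
   (1 - 2 * Cexp (- RtoC lambda) * Ccosh (tau * lambda)
      + Cexp (- (2 * lambda))))%C.

Definition f2 (tau : C) (lambda : R) : C :=
  (Ccos (lambda / 2) ^ 2 /
   (1 - 2 * Cexp (Ci * tau * lambda) * Ccos lambda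
      + Cexp (2 * Ci * tau * lambda)))%C.

Definition integrand (tau s : C) (lambda : R) : C :=
  (Rcpow lambda (s - 1) *
   (Cexp (- (Ci * s * PI / 2)) * Cexp (- RtoC lambda) * f1 tau lambda
    + Cexp (Ci * tau * lambda) * f2 tau lambda))%C.

Lemma Cexp_plus (z w : C) : Cexp (z + w) = (Cexp z * Cexp w)%C.
Proof.
destruct z as [a b], w as [c d].
unfold Cexp, Cplus, Cmult; simpl.
rewrite exp_plus, cos_plus, sin_plus.
apply injective_projections; simpl; ring.
Qed.

Lemma Cexp_0 : Cexp 0 = 1%C.
Proof.
unfold Cexp; simpl; rewrite exp_0, cos_0, sin_0.
apply injective_projections; simpl; ring.
Qed.

Lemma Cexp_nat_mult (k : nat) (z : C) : Cexp (RtoC (INR k) * z) = (Cexp z ^ k)%C.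
Proof.
induction k as [|k IH].
- simpl; rewrite Cmult_0_l; exact Cexp_0.
- rewrite S_INR, RtoC_plus, Cmult_plus_distr_r, Cmult_1_l, Cexp_plus, IH.
  rewrite Cpow_S; ring.
Qed.

Lemma Cexp_Arg (z : C) : z <> 0%C -> (Cmod z * Cexp (Ci * Arg z))%C = z.
Proof.
intros Hz.
assert (Hm : 0 < Cmod z) by (apply Cmod_gt_0; exact Hz).
assert (Hsq : Cmod z * Cmod z = Re z * Re z + Im z * Im z).
{ unfold Cmod, Re, Im; rewrite sqrt_sqrt; [ring|].
  generalize (pow2_ge_0 (fst z)) (pow2_ge_0 (snd z)); lra. }
set (c := Re z / Cmod z).
assert (Hc : Cmod z * c = Re z) by (unfold c; field; lra).
assert (Hs : Cmod z * Cmod z * (1 - c * c) = Im z * Im z).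
{ replace (Cmod z * Cmod z * (1 - c * c))
    with (Cmod z * Cmod z - (Cmod z * c) * (Cmod z * c)) by ring.
  rewrite Hc, Hsq; ring. }
assert (Hb : -1 <= c <= 1).
{ assert (0 <= 1 - c * c).
  { apply Rmult_le_reg_l with (Cmod z * Cmod z); [nra|].
    rewrite Hs, Rmult_0_r; nra. }
  split; nra. }
assert (Habs : Cmod z * sqrt (1 - c * c) = Rabs (Im z)).
{ rewrite <- (sqrt_Rsqr (Cmod z)) at 1 by lra.
  rewrite <- sqrt_mult_alt by (unfold Rsqr; nra).
  unfold Rsqr; rewrite Hs; apply sqrt_Rsqr_abs. }
assert (E : forall t : R, Cexp (Ci * t) = (cos t, sin t)).
{ intros t; unfold Cexp; simpl.
  replace (0 * t - 1 * 0) with 0 by ring.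
  replace (0 * 0 + 1 * t) with t by ring.
  rewrite exp_0; apply injective_projections; simpl; ring. }
rewrite E; unfold Arg; fold c.
assert (P : cos (acos c) = c) by (apply cos_acos; exact Hb).
assert (Q : sin (acos c) = sqrt (1 - c * c)).
{ rewrite sin_acos by exact Hb; unfold Rsqr; reflexivity. }
destruct (Rle_dec 0 (Im z)) as [H|H].
- rewrite P, Q.
  rewrite Rabs_right in Habs by lra.
  apply injective_projections; simpl;
    [change (fst z) with (Re z)|change (snd z) with (Im z)]; lra.
- rewrite cos_neg, sin_neg, P, Q.
  rewrite Rabs_left in Habs by lra.
  apply injective_projections; simpl;
    [change (fst z) with (Re z)|change (snd z) with (Im z)]; lra.
Qed.

Lemma Cexp_add_2PI (t : R) :
  Cexp (Ci * (t + 2 * PI)) = Cexp (Ci * t).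
Proof.
rewrite <- !RtoC_mult, <- RtoC_plus.
unfold Cexp; simpl.
replace (0 * 0 + 1 * (t + 2 * PI)) with (t + 2 * PI) by ring.
replace (0 * 0 + 1 * t) with t by ring.
replace (0 * (t + 2 * PI) - 1 * 0) with (0 * t - 1 * 0) by ring.
rewrite cos_plus, sin_plus, cos_2PI, sin_2PI.
apply injective_projections; simpl; ring.
Qed.

Lemma Rcpow_nat (x : R) (k : nat) : 0 < x -> Rcpow x (INR k) = (x ^ k)%C.
Proof.
intros Hx; unfold Rcpow; rewrite Cexp_nat_mult; f_equal.
unfold Cexp; simpl; rewrite exp_ln, cos_0, sin_0 by exact Hx.
apply injective_projections; simpl; ring.
Qed.

Lemma Cexp_arg_from (theta : R) (w : C) :
  Cexp (Ci * arg_from theta w) = Cexp (Ci * Arg w).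
Proof.
unfold arg_from; destruct (Rlt_dec (Arg w) theta); [|reflexivity].
rewrite RtoC_plus, RtoC_mult; apply Cexp_add_2PI.
Qed.

Lemma Cpow_from_nat (theta : R) (w : C) (k : nat) :
  w <> 0%C -> Cpow_from theta w (INR k) = (w ^ k)%C.
Proof.
intros Hw; unfold Cpow_from.
rewrite Rcpow_nat by (apply Cmod_gt_0; exact Hw).
replace (Ci * INR k * arg_from theta w)%C
  with (INR k * (Ci * arg_from theta w))%C by ring.
rewrite Cexp_nat_mult, Cexp_arg_from, <- Cpow_mult_l, Cexp_Arg by exact Hw.
reflexivity.
Qed.

Lemma lattice_term_nat (tau : C) (k : nat) (m n : Z) :
  0 < Im tau -> (m <> 0 \/ n <> 0)%Z ->
  lattice_term tau (INR k) m n = (1 / (IZR m + IZR n * tau) ^ k)%C.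
Proof.
intros Htau Hmn.
assert (Hw : (IZR m + IZR n * tau)%C <> 0%C).
{ intros H.
  assert (Hi := f_equal Im H); assert (Hr := f_equal Re H).
  simpl in Hi, Hr.
  unfold Im in Htau; simpl in Htau.
  assert (Hn : IZR n = 0).
  { apply Rmult_eq_reg_r with (snd tau); lra. }
  rewrite Hn in Hr.
  destruct Hmn as [Hm|Hn'].
  - apply Hm, eq_IZR; lra.
  - apply Hn', eq_IZR; lra. }
unfold lattice_term.
destruct (Z.eqb m 0 && Z.eqb n 0)%bool eqn:E0.
{ apply Bool.andb_true_iff in E0; destruct E0 as [A B].
  apply Z.eqb_eq in A, B; lia. }
destruct (Z.eqb m n && Z.ltb m 0)%bool eqn:E1.
- apply Bool.andb_true_iff in E1; destruct E1 as [A B].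
  apply Z.eqb_eq in A; apply Z.ltb_lt in B; subst n.
  assert (Hp : 0 < IZR (- m)) by (apply IZR_lt; lia).
  set (v := (- (1) - tau)%C).
  assert (Hv : v <> 0%C).
  { intros H; apply (f_equal Im) in H; simpl in H.
    unfold Im in Htau; simpl in Htau; lra. }
  assert (Hc : Cmod (1 + tau) = Cmod v).
  { rewrite <- Cmod_opp; f_equal; unfold v; ring. }
  assert (Hvm : 0 < Cmod v) by (apply Cmod_gt_0; exact Hv).
  rewrite Hc, Rcpow_nat by (apply Rmult_lt_0_compat; assumption).
  unfold theta_cut; fold v.
  set (t := Arg v).
  assert (I1 : forall x : C, (Cexp (- x) * Cexp x)%C = 1%C).
  { intros x; rewrite <- Cexp_plus, <- Cexp_0; f_equal; ring. }
  set (u := Cexp (Ci * t)).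
  assert (Hu : u <> 0%C).
  { intros H; assert (G := I1 (Ci * t)%C); fold u in G.
    rewrite H, Cmult_0_r in G; apply C1_nz; symmetry; exact G. }
  assert (K1 : Cexp (- (Ci * t * INR k)) = (/ u ^ k)%C).
  { assert (G := I1 (INR k * (Ci * t))%C).
    rewrite (Cexp_nat_mult k (Ci * t)) in G; fold u in G.
    replace (Ci * t * INR k)%C with (INR k * (Ci * t))%C by ring.
    rewrite <- (Cmult_1_l (/ u ^ k)), <- G.
    field; apply Cpow_nz; exact Hu. }
  assert (K2 : Cexp (- (Ci * (t + 2 * PI) * INR k)) = (/ u ^ k)%C).
  { assert (G := I1 (INR k * (Ci * (t + 2 * PI)))%C).
    rewrite (Cexp_nat_mult k (Ci * (t + 2 * PI))), Cexp_add_2PI in G; fold u in G.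
    replace (Ci * (t + 2 * PI) * INR k)%C
      with (INR k * (Ci * (t + 2 * PI)))%C by ring.
    rewrite <- (Cmult_1_l (/ u ^ k)), <- G.
    field; apply Cpow_nz; exact Hu. }
  rewrite K1, K2.
  replace (IZR m + IZR m * tau)%C with (RtoC (IZR (- m) * Cmod v) * u)%C.
  + rewrite Cpow_mult_l.
    assert (RtoC (IZR (- m) * Cmod v) <> 0%C).
    { intros H; apply RtoC_inj in H; nra. }
    assert (Two : RtoC 2 <> 0%C) by (intros H2; apply RtoC_inj in H2; lra).
    field; repeat split; try exact Two; apply Cpow_nz; assumption.
  + rewrite RtoC_mult, <- Cmult_assoc; unfold u, t.
    rewrite Cexp_Arg by exact Hv.
    unfold v; rewrite opp_IZR, RtoC_opp; ring.
- rewrite Cpow_from_nat by exact Hw; reflexivity.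
Qed.

(* Main.v *)
(* For [Re w > 0], [w^(-s) Gamma(s)] is the integral over [(0, oo)] of
   [x^(s-1) e^(-wx)]: rotating [w] to [1] changes nothing, as the derivative along the
   rotation is an exact derivative in [x].  The diagonals [m = n] and [m = -n] cut the
   lattice into four sectors, points on the diagonals being shared equally by two
   sectors.  A rotation by [0], [- pi/2], [pi/2] or [pi] takes each sector into
   [Re w > 0].  The cut lies on the diagonal between the left and the lower sector,
   and averaging the two boundary values there is exactly this sharing.
   Summing [e^(-wx)] over a sector with these weights gives [2 e^(-x) f1], resp.
   [2 e^(i tau x) f2].  The tail of the sector sum from row [K + 1] on is at
   most [C x^(-2) e^(-(K + 1) c x)], so after multiplication by [x^(s-1)] its integral is
   [O(K^(2 - Re s))].  Finally [Gamma(s)] must not vanish: by the functional equation one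
   may take [Re s] large, where the integrand of [Gamma] has almost constant
   phase near its peak. *)
Require Import Defs.
From Stdlib Require Import Reals ZArith Lra Lia.
From Coquelicot Require Import Coquelicot.
Open Scope R_scope.

(** * Complex-valued functions: continuity and derivatives *)

(** No double series is rearranged: the points of the square [K + 1] outside the square [K] form row
    [K + 1] of each of the four sectors, so a square sum is exactly a combination of partial sector
    sums. The left and lower sectors are the negatives of the right and upper ones, which leaves two
    sectors to integrate: the points [k p + j r] with [|j| <= k] and [k >= 1], for
    [(p, r) = (1, tau)] and [(- i tau, i)]. Exchanging sum and integral rests on the explicit tail
    bound. The [x^(-2)] in it is the price of summing a two-dimensional family near [x = 0]; it
    leaves [x^(s-3)], which is integrable there exactly when [Re s > 2]. The exchange gives only the
    limit of [Gamma(s)] times the sector sums. As [CGamma] is known through its integral alone, its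
    nonvanishing has to come from that integral too, by comparing [Gamma(a + iy)] with the positive
    number [Gamma(a)]. The rotation runs along a path with a real parameter, so that real-variable
    calculus on the two components takes the place of contour integration. *)

Lemma norm_C_R (z : C) : norm (K := R_AbsRing) (V := C_R_NormedModule) z = Cmod z.
Proof.
unfold norm, Cmod; simpl; unfold prod_norm, norm; simpl; unfold abs; simpl.
f_equal; rewrite !Rmult_1_r, <- !Rabs_mult, !Rabs_pos_eq; nra.
Qed.

Lemma Cmod_Cexp (z : C) : Cmod (Cexp z) = exp (Re z).
Proof.
unfold Cexp, Cmod; simpl.
replace (_ + _) with (exp (Re z) * exp (Re z)).
- apply sqrt_square; left; apply exp_pos.
- pose proof (sin2_cos2 (Im z)) as H; unfold Rsqr in H.
  transitivity (exp (Re z) * exp (Re z) *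
    (sin (Im z) * sin (Im z) + cos (Im z) * cos (Im z))); [rewrite H|]; ring.
Qed.

Lemma Cexp_neq_0 (z : C) : Cexp z <> 0%C.
Proof.
intros H; apply (f_equal Cmod) in H.
rewrite Cmod_Cexp, Cmod_0 in H; pose proof (exp_pos (Re z)); lra.
Qed.

Lemma Cexp_opp (z : C) : Cexp (- z) = (/ Cexp z)%C.
Proof.
rewrite <- (Cmult_1_l (/ Cexp z)), <- Cexp_0, <- (Cplus_opp_r z), Cexp_plus.
field; apply Cexp_neq_0.
Qed.

Lemma continuous_Rplus {U : UniformSpace} (f g : U -> R) (x : U) :
  continuous f x -> continuous g x -> continuous (fun y => f y + g y) x.
Proof. exact (continuous_plus (V := R_NormedModule) f g x). Qed.

Lemma continuous_Ropp {U : UniformSpace} (f : U -> R) (x : U) :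
  continuous f x -> continuous (fun y => - f y) x.
Proof. exact (continuous_opp (V := R_NormedModule) f x). Qed.

Lemma continuous_Rmult {U : UniformSpace} (f g : U -> R) (x : U) :
  continuous f x -> continuous g x -> continuous (fun y => f y * g y) x.
Proof. exact (continuous_mult (K := R_AbsRing) f g x). Qed.

Lemma continuous_C_pair {U : UniformSpace} (f : U -> C) (x : U) :
  continuous (fun y => fst (f y)) x -> continuous (fun y => snd (f y)) x ->
  continuous f x.
Proof.
intros H1 H2; apply (continuous_ext (fun y => (fst (f y), snd (f y)))).
{ intros y; destruct (f y); reflexivity. }
intros P [eps HP].
assert (K1 := H1 (ball (fst (f x)) eps) (locally_ball _ _)).
assert (K2 := H2 (ball (snd (f x)) eps) (locally_ball _ _)).
unfold filtermap in *.
refine (filter_imp _ _ _ (filter_and _ _ K1 K2)).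
intros y [A B]; apply HP; split; assumption.
Qed.

Lemma continuous_C_fst {U : UniformSpace} (f : U -> C) (x : U) :
  continuous f x -> continuous (fun y => fst (f y)) x.
Proof.
intros H; apply (continuous_comp f fst x H); apply continuous_fst.
Qed.

Lemma continuous_C_snd {U : UniformSpace} (f : U -> C) (x : U) :
  continuous f x -> continuous (fun y => snd (f y)) x.
Proof.
intros H; apply (continuous_comp f snd x H); apply continuous_snd.
Qed.

Lemma continuous_RtoC {U : UniformSpace} (f : U -> R) (x : U) :
  continuous f x -> continuous (fun y => RtoC (f y)) x.
Proof.
intros H; apply continuous_C_pair; simpl; [exact H|apply continuous_const].
Qed.

Lemma continuous_Cplus {U : UniformSpace} (f g : U -> C) (x : U) :
  continuous f x -> continuous g x -> continuous (fun y => f y + g y)%C x.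
Proof.
intros Hf Hg; apply continuous_C_pair.
- exact (continuous_Rplus _ _ x (continuous_C_fst f x Hf) (continuous_C_fst g x Hg)).
- exact (continuous_Rplus _ _ x (continuous_C_snd f x Hf) (continuous_C_snd g x Hg)).
Qed.

Lemma continuous_Copp {U : UniformSpace} (f : U -> C) (x : U) :
  continuous f x -> continuous (fun y => - f y)%C x.
Proof.
intros Hf; apply continuous_C_pair.
- exact (continuous_Ropp _ x (continuous_C_fst f x Hf)).
- exact (continuous_Ropp _ x (continuous_C_snd f x Hf)).
Qed.

Lemma continuous_Cmult {U : UniformSpace} (f g : U -> C) (x : U) :
  continuous f x -> continuous g x -> continuous (fun y => f y * g y)%C x.
Proof.
intros Hf Hg.
assert (H1 := continuous_C_fst f x Hf); assert (H2 := continuous_C_snd f x Hf).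
assert (H3 := continuous_C_fst g x Hg); assert (H4 := continuous_C_snd g x Hg).
apply continuous_C_pair.
- exact (continuous_Rplus _ _ x (continuous_Rmult _ _ x H1 H3)
    (continuous_Ropp _ x (continuous_Rmult _ _ x H2 H4))).
- exact (continuous_Rplus _ _ x (continuous_Rmult _ _ x H1 H4)
    (continuous_Rmult _ _ x H2 H3)).
Qed.

Lemma continuous_Cexp {U : UniformSpace} (f : U -> C) (x : U) :
  continuous f x -> continuous (fun y => Cexp (f y)) x.
Proof.
intros Hf.
assert (H1 := continuous_C_fst f x Hf); assert (H2 := continuous_C_snd f x Hf).
assert (He := continuous_comp _ exp x H1 (continuous_exp _)).
apply continuous_C_pair.
- exact (continuous_Rmult _ _ x He (continuous_comp _ cos x H2 (continuous_cos _))).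
- exact (continuous_Rmult _ _ x He (continuous_comp _ sin x H2 (continuous_sin _))).
Qed.

Lemma continuous_Rinv_comp {U : UniformSpace} (f : U -> R) (x : U) :
  continuous f x -> f x <> 0 -> continuous (fun y => / f y) x.
Proof.
intros Hf H0; apply (continuous_comp f Rinv); [exact Hf|].
apply continuous_Rinv; exact H0.
Qed.

Lemma Cmod2_neq_0 (z : C) : z <> 0%C -> fst z ^ 2 + snd z ^ 2 <> 0.
Proof.
intros Hz H; apply Hz.
destruct z as [a b]; simpl in *; apply injective_projections; simpl; nra.
Qed.

Lemma continuous_Cinv {U : UniformSpace} (f : U -> C) (x : U) :
  continuous f x -> f x <> 0%C -> continuous (fun y => / f y)%C x.
Proof.
intros Hf H0.
assert (H1 := continuous_C_fst f x Hf); assert (H2 := continuous_C_snd f x Hf).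
assert (H : continuous (fun y => / (fst (f y) ^ 2 + snd (f y) ^ 2)) x).
{ apply continuous_Rinv_comp; [|apply Cmod2_neq_0, H0].
  assert (C1 := continuous_const (V := R_UniformSpace) 1 x).
  exact (continuous_Rplus _ _ x
    (continuous_Rmult _ _ x H1 (continuous_Rmult _ _ x H1 C1))
    (continuous_Rmult _ _ x H2 (continuous_Rmult _ _ x H2 C1))). }
apply continuous_C_pair.
- exact (continuous_Rmult _ _ x H1 H).
- exact (continuous_Rmult _ _ x (continuous_Ropp _ x H2) H).
Qed.

Lemma continuous_ln_comp {U : UniformSpace} (f : U -> R) (x : U) :
  continuous f x -> 0 < f x -> continuous (fun y => ln (f y)) x.
Proof.
intros Hf H0; apply (continuous_comp f ln); [exact Hf|].
apply continuous_ln; exact H0.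
Qed.

Lemma is_derive_C_pair (f : R -> C) (x : R) (l : C) :
  is_derive (fun t => fst (f t)) x (fst l) ->
  is_derive (fun t => snd (f t)) x (snd l) ->
  is_derive (V := C_R_NormedModule) f x l.
Proof.
intros H1 H2.
apply (is_derive_ext (V := C_R_NormedModule) (fun y => (fst (f y), snd (f y)) : C)).
{ intros y; destruct (f y); reflexivity. }
unfold is_derive in *.
apply (filterdiff_ext_lin _
  (fun y : R => (scal y (fst l), scal y (snd l)) : C_R_NormedModule)).
2:{ intros y; destruct l; reflexivity. }
apply (filterdiff_comp_2 (U := R_NormedModule) (V := R_NormedModule)
  (W := C_R_NormedModule) _ _ (fun a b => (a, b) : C) _ _ (fun a b => (a, b) : C));
  auto.
apply (filterdiff_linear (U := prod_NormedModule R_AbsRing R_NormedModule R_NormedModule)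
  (V := C_R_NormedModule) (fun t => (fst t, snd t))).
split.
- intros [a b] [c d]; reflexivity.
- intros k [a b]; reflexivity.
- exists 1; split; [lra|]; intros [a b].
  rewrite Rmult_1_l; apply Rle_refl.
Qed.

Lemma is_derive_C_fst (f : R -> C) (x : R) (l : C) :
  is_derive (V := C_R_NormedModule) f x l -> is_derive (fun t => fst (f t)) x (fst l).
Proof.
intros H; unfold is_derive in *.
apply (filterdiff_ext_lin _ (fun y : R => fst (scal (V := C_R_NormedModule) y l))).
2: { intros; reflexivity. }
apply (filterdiff_comp (V := C_R_NormedModule) f (fst : C -> R) _ (fst : C -> R) H).
apply (filterdiff_linear (U := C_R_NormedModule) (V := R_NormedModule)).
apply (is_linear_fst (U := R_NormedModule) (V := R_NormedModule)).
Qed.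

Lemma is_derive_C_snd (f : R -> C) (x : R) (l : C) :
  is_derive (V := C_R_NormedModule) f x l -> is_derive (fun t => snd (f t)) x (snd l).
Proof.
intros H; unfold is_derive in *.
apply (filterdiff_ext_lin _ (fun y : R => snd (scal (V := C_R_NormedModule) y l))).
2: { intros; reflexivity. }
apply (filterdiff_comp (V := C_R_NormedModule) f (snd : C -> R) _ (snd : C -> R) H).
apply (filterdiff_linear (U := C_R_NormedModule) (V := R_NormedModule)).
apply (is_linear_snd (U := R_NormedModule) (V := R_NormedModule)).
Qed.

Lemma is_derive_Rmult (u v : R -> R) (x du dv : R) :
  is_derive u x du -> is_derive v x dv ->
  is_derive (fun t => u t * v t) x (du * v x + u x * dv).
Proof.
intros H1 H2.
exact (is_derive_mult (K := R_AbsRing) u v x du dv H1 H2 Rmult_comm).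
Qed.

Lemma is_derive_Cexp (f : R -> C) (x : R) (l : C) :
  is_derive (V := C_R_NormedModule) f x l ->
  is_derive (V := C_R_NormedModule) (fun t => Cexp (f t)) x (l * Cexp (f x))%C.
Proof.
intros H.
assert (H1 := is_derive_C_fst _ _ _ H); assert (H2 := is_derive_C_snd _ _ _ H).
assert (He := is_derive_comp exp _ x _ _ (is_derive_exp _) H1).
assert (Hc := is_derive_comp cos _ x _ _ (is_derive_cos _) H2).
assert (Hs := is_derive_comp sin _ x _ _ (is_derive_sin _) H2).
apply is_derive_C_pair.
- refine (eq_ind _ (is_derive _ x) (is_derive_Rmult _ _ _ _ _ He Hc) _ _).
  unfold scal; simpl; unfold mult, Re, Im; simpl; ring.
- refine (eq_ind _ (is_derive _ x) (is_derive_Rmult _ _ _ _ _ He Hs) _ _).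
  unfold scal; simpl; unfold mult, Re, Im; simpl; ring.
Qed.

Lemma is_derive_Cmult (f g : R -> C) (x : R) (lf lg : C) :
  is_derive (V := C_R_NormedModule) f x lf ->
  is_derive (V := C_R_NormedModule) g x lg ->
  is_derive (V := C_R_NormedModule) (fun t => f t * g t)%C x (lf * g x + f x * lg)%C.
Proof.
intros Hf Hg.
assert (H1 := is_derive_C_fst _ _ _ Hf); assert (H2 := is_derive_C_snd _ _ _ Hf).
assert (H3 := is_derive_C_fst _ _ _ Hg); assert (H4 := is_derive_C_snd _ _ _ Hg).
apply is_derive_C_pair.
- refine (eq_ind _ (is_derive _ x) (is_derive_minus _ _ x _ _
    (is_derive_Rmult _ _ _ _ _ H1 H3) (is_derive_Rmult _ _ _ _ _ H2 H4)) _ _).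
  unfold minus, plus, opp; simpl; ring.
- refine (eq_ind _ (is_derive _ x) (is_derive_plus _ _ x _ _
    (is_derive_Rmult _ _ _ _ _ H1 H4) (is_derive_Rmult _ _ _ _ _ H2 H3)) _ _).
  unfold plus; simpl; ring.
Qed.

(** * Complex improper integrals over (0, oo) *)

Definition is_CRInt (f : R -> C) (a b : R) (l : C) : Prop :=
  is_RInt (V := C_R_NormedModule) f a b l.

Definition is_CRInt_0_infty (f : R -> C) (l : C) : Prop :=
  is_RInt_gen (V := C_R_NormedModule) f (at_right 0) (Rbar_locally p_infty) l.

Lemma is_CRInt_0_infty_unique (f : R -> C) (l : C) :
  is_CRInt_0_infty f l -> CRInt_0_infty f = l.
Proof.
exact (is_RInt_gen_unique (V := C_R_CompleteNormedModule) f l).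
Qed.

(** The clause [d <= M] forces [a < b], so that every integral considered is oriented forward and
    can be compared with a majorant. *)
Lemma is_CRInt_0_infty_eps (f : R -> C) (l : C) :
  is_CRInt_0_infty f l <->
  forall eps, 0 < eps -> exists d M, 0 < d <= M /\
    forall a b, 0 < a < d -> M < b ->
      exists y, is_CRInt f a b y /\ Cmod (y - l) < eps.
Proof.
split.
- intros H eps Heps.
  assert (HP : locally (T := C_R_NormedModule) l (fun y => Cmod (y - l) < eps)).
  { apply (locally_le_locally_norm (V := C_R_NormedModule)).
    exists (mkposreal eps Heps); intros y Hy.
    unfold ball_norm in Hy; rewrite norm_C_R in Hy; exact Hy. }
  destruct (H _ HP) as [Q S [d Hd] [M HM] HQS].
  exists d, (Rmax d M); split; [split; [apply d|apply Rmax_l]|].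
  intros a b Ha Hb.
  apply HQS.
  + apply Hd; [|apply Ha].
    unfold ball; simpl; unfold AbsRing_ball, abs, minus, plus, opp; simpl.
    rewrite Rabs_pos_eq; lra.
  + apply HM; apply Rle_lt_trans with (2 := Hb), Rmax_r.
- intros H P HP.
  apply (locally_norm_le_locally (V := C_R_NormedModule)) in HP.
  destruct HP as [eps HP].
  destruct (H eps (cond_pos eps)) as [d [M [Hd HM]]].
  apply Filter_prod with (fun a => 0 < a < d) (fun b => M < b).
  + exists (mkposreal d (proj1 Hd)); intros y Hy Hy0; split; [exact Hy0|].
    unfold ball in Hy; simpl in Hy; unfold AbsRing_ball, abs, minus, plus, opp in Hy; simpl in Hy.
    rewrite Rabs_pos_eq in Hy; lra.
  + exists M; intros y Hy; exact Hy.
  + intros a b Ha Hb; destruct (HM a b Ha Hb) as [y [Hy1 Hy2]].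
    exists y; split; [exact Hy1|]; apply HP.
    unfold ball_norm; rewrite norm_C_R; exact Hy2.
Qed.

Lemma is_CRInt_unique (f : R -> C) (a b : R) (l l' : C) :
  is_CRInt f a b l -> is_CRInt f a b l' -> l = l'.
Proof.
intros H H'.
rewrite <- (is_RInt_unique (V := C_R_CompleteNormedModule) f a b l H).
exact (is_RInt_unique (V := C_R_CompleteNormedModule) f a b l' H').
Qed.

Lemma Cmod_minus_sym (x y : C) : Cmod (x - y) = Cmod (y - x).
Proof. rewrite <- Cmod_opp; f_equal; ring. Qed.

Lemma is_CRInt_Cmult (c : C) (f : R -> C) (a b : R) (l : C) :
  is_CRInt f a b l -> is_CRInt (fun x => c * f x)%C a b (c * l)%C.
Proof.
intros H.
assert (H1 := is_RInt_fct_extend_fst (U := R_NormedModule) (V := R_NormedModule) f a b l H).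
assert (H2 := is_RInt_fct_extend_snd (U := R_NormedModule) (V := R_NormedModule) f a b l H).
apply (is_RInt_fct_extend_pair (U := R_NormedModule) (V := R_NormedModule)
  (fun x => c * f x)%C a b (fst c * fst l - snd c * snd l) (fst c * snd l + snd c * fst l)).
- exact (is_RInt_minus (V := R_NormedModule) _ _ a b _ _
    (is_RInt_scal (V := R_NormedModule) _ a b (fst c) _ H1)
    (is_RInt_scal (V := R_NormedModule) _ a b (snd c) _ H2)).
- exact (is_RInt_plus (V := R_NormedModule) _ _ a b _ _
    (is_RInt_scal (V := R_NormedModule) _ a b (fst c) _ H2)
    (is_RInt_scal (V := R_NormedModule) _ a b (snd c) _ H1)).
Qed.

Lemma is_CRInt_0_infty_Cmult (c : C) (f : R -> C) (l : C) :
  is_CRInt_0_infty f l -> is_CRInt_0_infty (fun x => c * f x)%C (c * l)%C.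
Proof.
rewrite !is_CRInt_0_infty_eps; intros H eps Heps.
assert (Hc := Cmod_ge_0 c).
destruct (H (eps / (Cmod c + 1))) as [d [M [Hd HM]]].
{ apply Rdiv_lt_0_compat; lra. }
exists d, M; split; [exact Hd|]; intros a b Ha Hb.
destruct (HM a b Ha Hb) as [y [Hy1 Hy2]].
exists (c * y)%C; split; [apply is_CRInt_Cmult, Hy1|].
replace (c * y - c * l)%C with (c * (y - l))%C by ring.
rewrite Cmod_mult.
apply Rle_lt_trans with (Cmod c * (eps / (Cmod c + 1))).
- apply Rmult_le_compat_l; lra.
- apply Rlt_le_trans with ((Cmod c + 1) * (eps / (Cmod c + 1))).
  + apply Rmult_lt_compat_r; [apply Rdiv_lt_0_compat; lra|lra].
  + apply Req_le; field; lra.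
Qed.

Lemma is_CRInt_0_infty_plus (f g : R -> C) (lf lg : C) :
  is_CRInt_0_infty f lf -> is_CRInt_0_infty g lg ->
  is_CRInt_0_infty (fun x => f x + g x)%C (lf + lg)%C.
Proof.
exact (is_RInt_gen_plus (V := C_R_NormedModule) f g lf lg).
Qed.

Lemma is_CRInt_0_infty_minus (f g : R -> C) (lf lg : C) :
  is_CRInt_0_infty f lf -> is_CRInt_0_infty g lg ->
  is_CRInt_0_infty (fun x => f x - g x)%C (lf - lg)%C.
Proof.
exact (is_RInt_gen_minus (V := C_R_NormedModule) f g lf lg).
Qed.

Lemma is_CRInt_0_infty_ext (f g : R -> C) (l : C) :
  (forall x, 0 < x -> f x = g x) -> is_CRInt_0_infty f l -> is_CRInt_0_infty g l.
Proof.
intros E; rewrite !is_CRInt_0_infty_eps; intros H eps Heps.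
destruct (H eps Heps) as [d [M [Hd HM]]].
exists d, M; split; [exact Hd|]; intros a b Ha Hb.
destruct (HM a b Ha Hb) as [y [Hy1 Hy2]].
exists y; split; [|exact Hy2].
apply (is_RInt_ext (V := C_R_NormedModule)) with (2 := Hy1).
intros x; rewrite Rmin_left by lra; intros Hx; apply E; lra.
Qed.

Lemma is_CRInt_0_infty_zero : is_CRInt_0_infty (fun _ => 0%C) 0%C.
Proof.
apply is_CRInt_0_infty_eps; intros eps Heps; exists 1, 1; split; [lra|].
intros a b Ha Hb; exists 0%C; split.
- assert (H := is_CRInt_Cmult 0 _ a b _
    (is_RInt_const (V := C_R_NormedModule) a b (RtoC 0))).
  apply (is_RInt_ext (V := C_R_NormedModule)) with
    (2 := eq_ind _ (is_CRInt _ a b) H _ (Cmult_0_l _)).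
  intros; apply Cmult_0_l.
- assert (E : Cmod (0 - 0) = 0) by (rewrite <- Cmod_0; f_equal; ring).
  rewrite <- E in Heps; exact Heps.
Qed.

(** The majorant is complex-valued and enters through its real part, so that a single notion of
    integral serves both functions and bounds. *)
Lemma Cmod_is_CRInt_le (f g : R -> C) (a b : R) (lf lg : C) :
  a <= b -> (forall x, a <= x <= b -> Cmod (f x) <= Re (g x)) ->
  is_CRInt f a b lf -> is_CRInt g a b lg -> Cmod lf <= Re lg.
Proof.
intros Hab H Hf Hg.
rewrite <- norm_C_R.
apply (norm_RInt_le (V := C_R_NormedModule) f (fun x => Re (g x)) a b lf (Re lg) Hab).
- intros x Hx; rewrite norm_C_R; apply H, Hx.
- exact Hf.
- exact (is_RInt_fct_extend_fst (U := R_NormedModule) (V := R_NormedModule) g a b lg Hg).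
Qed.

Lemma Re_le_Cmod (z : C) : Re z <= Cmod z.
Proof.
apply Rle_trans with (Rabs (Re z)); [apply Rle_abs|].
apply Rle_trans with (2 := Rmax_Cmod z), Rmax_l.
Qed.

Lemma Cmod_is_CRInt_0_infty_le (f g : R -> C) (lf lg : C) :
  (forall x, 0 < x -> Cmod (f x) <= Re (g x)) ->
  is_CRInt_0_infty f lf -> is_CRInt_0_infty g lg -> Cmod lf <= Re lg.
Proof.
rewrite !is_CRInt_0_infty_eps; intros H Hf Hg.
apply le_epsilon; intros eps Heps.
destruct (Hf (eps / 2)) as [d [M [Hd HM]]]; [lra|].
destruct (Hg (eps / 2)) as [d' [M' [Hd' HM']]]; [lra|].
set (a := Rmin d d' / 2); set (b := Rmax M M' + 1).
assert (Ha : 0 < Rmin d d') by (apply Rmin_glb_lt; lra).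
assert (A1 := Rmin_l d d'); assert (A2 := Rmin_r d d').
assert (A3 := Rmax_l M M'); assert (A4 := Rmax_r M M').
destruct (HM a b) as [y [Hy1 Hy2]]; [unfold a; lra|unfold b; lra|].
destruct (HM' a b) as [z [Hz1 Hz2]]; [unfold a; lra|unfold b; lra|].
assert (K : Cmod y <= Re z).
{ apply (Cmod_is_CRInt_le f g a b); auto; [unfold a, b; lra|].
  intros x Hx; apply H; unfold a in Hx; lra. }
assert (T1 : Cmod lf <= Cmod y + Cmod (y - lf)).
{ rewrite (Cmod_minus_sym y).
  replace lf with (y + (lf - y))%C at 1 by ring; apply Cmod_triangle. }
assert (T2 := Re_le_Cmod (z - lg)).
unfold Re in *; simpl in T2; lra.
Qed.

Lemma ex_is_CRInt (f : R -> C) (a b : R) :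
  0 < a -> 0 < b -> (forall x, 0 < x -> continuous f x) ->
  exists l, is_CRInt f a b l.
Proof.
intros Ha Hb Hf.
apply (ex_RInt_continuous (V := C_R_CompleteNormedModule)).
intros z Hz; apply Hf; apply Rlt_le_trans with (2 := proj1 Hz).
apply Rmin_glb_lt; assumption.
Qed.

Lemma ex_is_CRInt_0_infty (f g : R -> C) (lg : C) :
  (forall x, 0 < x -> continuous f x) ->
  (forall x, 0 < x -> Cmod (f x) <= Re (g x)) ->
  is_CRInt_0_infty g lg -> exists lf, is_CRInt_0_infty f lf.
Proof.
intros Hf H Hg; rewrite is_CRInt_0_infty_eps in Hg.
set (F := fun ab : R * R => RInt (V := C_R_CompleteNormedModule) f (fst ab) (snd ab)).
assert (HF : forall a b, 0 < a -> 0 < b -> is_CRInt f a b (F (a, b))).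
{ intros a b Ha Hb; apply (RInt_correct (V := C_R_CompleteNormedModule)).
  exact (ex_is_CRInt f a b Ha Hb Hf). }
assert (Cau : forall eps, 0 < eps -> exists d M, 0 < d <= M /\
  forall a b a' b', 0 < a < d -> M < b -> 0 < a' < d -> M < b' ->
  Cmod (F (a', b') - F (a, b)) < eps).
{ intros eps Heps.
  (* An end piece of the integral of [g] is the difference of two integrals within [eps / 5] of
     [lg], so each of the two end pieces costs at most [2 eps / 5]. *)
  destruct (Hg (eps / 5)) as [d [M [Hd HM]]]; [lra|].
  exists d, M; split; [exact Hd|].
  assert (L : forall a a', 0 < a <= a' -> a' < d -> Cmod (F (a, a')) <= 2 * eps / 5).
  { intros a a' Ha Ha'.
    destruct (HM a (M + 1)) as [y [Hy1 Hy2]]; [lra|lra|].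
    destruct (HM a' (M + 1)) as [z [Hz1 Hz2]]; [lra|lra|].
    assert (I := is_RInt_Chasles (V := C_R_NormedModule) _ _ _ _ _ _ Hy1
      (is_RInt_swap (V := C_R_NormedModule) _ _ _ _ Hz1)).
    assert (K := Cmod_is_CRInt_le f g a a' _ _ (proj2 Ha)
      (fun x Hx => H x (Rlt_le_trans _ _ _ (proj1 Ha) (proj1 Hx)))
      (HF a a' ltac:(lra) ltac:(lra)) I).
    change (plus y (opp z)) with (y - z)%C in K.
    assert (R1 := Re_le_Cmod (y - z)).
    assert (T : Cmod (y - z) <= Cmod (y - lg) + Cmod (z - lg)).
    { rewrite (Cmod_minus_sym z).
      replace (y - z)%C with ((y - lg) + (lg - z))%C by ring; apply Cmod_triangle. }
    lra. }
  assert (Rr : forall b b', M < b <= b' -> Cmod (F (b, b')) <= 2 * eps / 5).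
  { intros b b' Hb.
    destruct (HM (d / 2) b) as [y [Hy1 Hy2]]; [lra|lra|].
    destruct (HM (d / 2) b') as [z [Hz1 Hz2]]; [lra|lra|].
    assert (I := is_RInt_Chasles (V := C_R_NormedModule) _ _ _ _ _ _
      (is_RInt_swap (V := C_R_NormedModule) _ _ _ _ Hy1) Hz1).
    assert (K := Cmod_is_CRInt_le f g b b' _ _ (proj2 Hb)
      (fun x Hx => H x (Rlt_le_trans 0 b x ltac:(lra) (proj1 Hx)))
      (HF b b' ltac:(lra) ltac:(lra)) I).
    change (plus (opp y) z) with (- y + z)%C in K.
    assert (R1 := Re_le_Cmod (- y + z)).
    assert (T : Cmod (- y + z) <= Cmod (y - lg) + Cmod (z - lg)).
    { rewrite (Cmod_minus_sym y).
      replace (- y + z)%C with ((lg - y) + (z - lg))%C by ring; apply Cmod_triangle. }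
    lra. }
  (* The order of [a] and [a'], and of [b] and [b'], is unknown; reversing a piece changes only its
     sign. *)
  assert (SW : forall a b, 0 < a -> 0 < b -> Cmod (F (b, a)) = Cmod (F (a, b))).
  { intros a b Ha Hb.
    rewrite (is_CRInt_unique f b a _ _ (HF b a Hb Ha)
      (is_RInt_swap (V := C_R_NormedModule) _ _ _ _ (HF a b Ha Hb))).
    apply Cmod_opp. }
  intros a b a' b' Ha Hb Ha' Hb'.
  assert (E : F (a', b') = (F (a', a) + F (a, b) + F (b, b'))%C).
  { apply (is_CRInt_unique f a' b'); [apply HF; lra|].
    apply (is_RInt_Chasles (V := C_R_NormedModule) f a' b b').
    - apply (is_RInt_Chasles (V := C_R_NormedModule) f a' a b); apply HF; lra.
    - apply HF; lra. }
  replace (F (a', b') - F (a, b))%C with (F (a', a) + F (b, b'))%C by (rewrite E; ring).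
  apply Rle_lt_trans with (1 := Cmod_triangle _ _).
  assert (K1 : Cmod (F (a', a)) <= 2 * eps / 5).
  { destruct (Rle_dec a' a); [apply L; lra|rewrite SW by lra; apply L; lra]. }
  assert (K2 : Cmod (F (b, b')) <= 2 * eps / 5).
  { destruct (Rle_dec b b'); [apply Rr; lra|rewrite SW by lra; apply Rr; lra]. }
  lra. }
assert (FP : forall d M, 0 < d <= M -> filter_prod (at_right 0) (Rbar_locally p_infty)
   (fun ab => 0 < fst ab < d /\ M < snd ab)).
{ intros d M Hd.
  apply Filter_prod with (fun a => 0 < a < d) (fun b => M < b).
  + exists (mkposreal d (proj1 Hd)); intros y Hy Hy0; split; [exact Hy0|].
    unfold ball in Hy; simpl in Hy; unfold AbsRing_ball, abs, minus, plus, opp in Hy; simpl in Hy.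
    rewrite Rabs_pos_eq in Hy; lra.
  + exists M; intros y Hy; exact Hy.
  + intros a b Ha Hb; split; assumption. }
destruct (proj1 (filterlim_locally_cauchy (U := C_R_CompleteNormedModule)
  (F := filter_prod (at_right 0) (Rbar_locally p_infty)) F)) as [l Hl].
{ intros eps; destruct (Cau eps (cond_pos eps)) as [d [M [Hd HM]]].
  exists (fun ab => 0 < fst ab < d /\ M < snd ab); split; [apply FP, Hd|].
  intros [a b] [a' b'] [Ha Hb] [Ha' Hb']; simpl in Ha, Hb, Ha', Hb'.
  apply (norm_compat1 (V := C_R_NormedModule)).
  rewrite norm_C_R; apply HM; assumption. }
exists l; intros P HP.
assert (K0 : filter_prod (at_right 0) (Rbar_locally p_infty) (fun ab => P (F ab)))
  by exact (Hl P HP).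
assert (K := filter_and _ _ K0 (FP 1 1 ltac:(lra))).
unfold filtermapi; refine (filter_imp _ _ _ K).
intros [a b] [K1 K2]; simpl in K1, K2; exists (F (a, b)); split; [|exact K1].
apply HF; simpl; lra.
Qed.

(** * The rotated Euler integral *)

Lemma is_CRInt_0_infty_derive (F f : R -> C) (la lb : C) :
  (forall x, 0 < x -> is_derive (V := C_R_NormedModule) F x (f x)) ->
  (forall x, 0 < x -> continuous f x) ->
  (forall eps, 0 < eps -> exists d, 0 < d /\
     forall a, 0 < a < d -> Cmod (F a - la) < eps) ->
  (forall eps, 0 < eps -> exists M, forall b, M < b -> Cmod (F b - lb) < eps) ->
  is_CRInt_0_infty f (lb - la)%C.
Proof.
intros HF Hf Ha Hb; apply is_CRInt_0_infty_eps; intros eps Heps.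
destruct (Ha (eps / 2)) as [d [Hd Ha']]; [lra|].
destruct (Hb (eps / 2)) as [M Hb']; [lra|].
exists d, (Rmax d M); split; [split; [exact Hd|apply Rmax_l]|].
intros a b Hda HMb.
assert (A1 := Rmax_l d M); assert (A2 := Rmax_r d M).
exists (F b - F a)%C; split.
- apply (is_RInt_derive (V := C_R_CompleteNormedModule));
    intros x; rewrite Rmin_left by lra; intros Hx; [apply HF|apply Hf]; lra.
- replace (F b - F a - (lb - la))%C with ((F b - lb) - (F a - la))%C by ring.
  apply Rle_lt_trans with (1 := Cmod_triangle _ _); rewrite Cmod_opp.
  assert (G1 := Ha' a Hda); assert (G2 := Hb' b ltac:(lra)); lra.
Qed.

Lemma exp_le_compat (x y : R) : x <= y -> exp x <= exp y.
Proof.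
intros [H|H]; [left; apply exp_increasing, H|rewrite H; apply Rle_refl].
Qed.

(** The tangent line of [ln] at [1 / c]. The free slope [c] decides how much of an exponential decay
    is spent on a power. *)
Lemma ln_le_linear (c x : R) : 0 < c -> 0 < x -> ln x <= c * x - 1 - ln c.
Proof.
intros Hc Hx.
assert (H := exp_ineq1_le (ln (c * x))).
rewrite exp_ln in H by (apply Rmult_lt_0_compat; assumption).
rewrite ln_mult in H by assumption; lra.
Qed.

Lemma exp_mult_ln_small (alpha eps : R) : 0 < alpha -> 0 < eps ->
  exists d, 0 < d /\ forall x, 0 < x < d -> exp (alpha * ln x) < eps.
Proof.
intros Ha He; exists (exp (ln eps / alpha)); split; [apply exp_pos|].
intros x Hx; rewrite <- (exp_ln eps) by exact He.
apply exp_increasing.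
assert (H : ln x < ln eps / alpha).
{ rewrite <- (ln_exp (ln eps / alpha)); apply ln_increasing; lra. }
apply (Rmult_lt_compat_l alpha) in H; [|exact Ha].
replace (alpha * (ln eps / alpha)) with (ln eps) in H by (field; lra); lra.
Qed.

Lemma exp_power_exp_large (alpha kappa eps : R) : 0 < alpha -> 0 < kappa -> 0 < eps ->
  exists M, 0 < M /\ forall x, M < x -> exp (alpha * ln x - kappa * x) < eps.
Proof.
intros Ha Hk He.
(* This slope spends half of the decay: [alpha ln x <= kappa x / 2 + const]. [M0] is where the
   remaining half brings the exponent below [ln eps]. *)
set (c := kappa / (2 * alpha)).
assert (Hc : 0 < c) by (apply Rdiv_lt_0_compat; lra).
set (M0 := 2 / kappa * (alpha * (- 1 - ln c) - ln eps)).
exists (Rmax 1 M0); split; [apply Rlt_le_trans with (2 := Rmax_l _ _); lra|].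
intros x Hx.
assert (A1 := Rmax_l 1 M0); assert (A2 := Rmax_r 1 M0).
rewrite <- (exp_ln eps) by exact He; apply exp_increasing.
assert (H := ln_le_linear c x Hc ltac:(lra)).
apply (Rmult_le_compat_l alpha) in H; [|lra].
assert (E : alpha * (c * x) = kappa / 2 * x) by (unfold c; field; lra).
assert (G : kappa / 2 * M0 < kappa / 2 * x) by (apply Rmult_lt_compat_l; lra).
replace (kappa / 2 * M0) with (alpha * (- 1 - ln c) - ln eps) in G by (unfold M0; field; lra).
lra.
Qed.

Lemma Cmod_RtoC_pos (x : R) : 0 <= x -> Cmod (RtoC x) = x.
Proof. intros H; rewrite Cmod_R; apply Rabs_pos_eq, H. Qed.

Lemma is_derive_RtoC (f : R -> R) (x l : R) :
  is_derive f x l -> is_derive (V := C_R_NormedModule) (fun t => RtoC (f t)) x (RtoC l).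
Proof.
intros H; apply is_derive_C_pair; [exact H|].
apply (is_derive_const (V := R_NormedModule) 0 x).
Qed.

(* The integral over (0, oo) of the derivative of [(x / (1 + x)) ^ alpha]. *)
Lemma is_CRInt_0_infty_dominator (alpha : R) : 0 < alpha ->
  is_CRInt_0_infty
    (fun x => RtoC (exp (alpha * (ln x - ln (1 + x))) * (alpha * (/ x - / (1 + x)))))
    1%C.
Proof.
intros Ha.
replace (RtoC 1) with (1 - 0)%C by ring.
apply (is_CRInt_0_infty_derive (fun x => RtoC (exp (alpha * (ln x - ln (1 + x)))))).
- intros x Hx; apply is_derive_RtoC.
  auto_derive; [lra|]. unfold Rminus, Rdiv; ring.
- intros x Hx; apply continuous_RtoC, (ex_derive_continuous (V := R_NormedModule)).
  auto_derive; repeat split; lra.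
- intros eps He; destruct (exp_mult_ln_small alpha eps Ha He) as [d [Hd H]].
  exists d; split; [exact Hd|]; intros a Hda.
  replace (_ - 0)%C with (RtoC (exp (alpha * (ln a - ln (1 + a))))) by ring.
  rewrite Cmod_RtoC_pos by (left; apply exp_pos).
  apply Rle_lt_trans with (2 := H a Hda), exp_le_compat.
  assert (0 < ln (1 + a)) by (rewrite <- ln_1; apply ln_increasing; lra).
  apply Rmult_le_compat_l; lra.
(* The threshold comes from [1 - (b / (1 + b))^alpha <= alpha (ln (1 + b) - ln b) <= alpha / b]. *)
- intros eps He; exists (Rmax 1 (alpha / eps)); intros b Hb.
  assert (A1 := Rmax_l 1 (alpha / eps)); assert (A2 := Rmax_r 1 (alpha / eps)).
  assert (L1 : ln b < ln (1 + b)) by (apply ln_increasing; lra).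
  assert (L2 : ln (1 + b) - ln b <= / b).
  { assert (H := ln_le_linear (/ b) (1 + b) ltac:(apply Rinv_0_lt_compat; lra) ltac:(lra)).
    rewrite ln_Rinv in H by lra.
    replace (/ b * (1 + b)) with (/ b + 1) in H by (field; lra); lra. }
  assert (U : exp (alpha * (ln b - ln (1 + b))) < 1).
  { apply Rlt_le_trans with (exp 0); [apply exp_increasing; nra|rewrite exp_0; lra]. }
  assert (V : 1 - alpha / b <= exp (alpha * (ln b - ln (1 + b)))).
  { apply Rle_trans with (2 := exp_ineq1_le _).
    unfold Rdiv; nra. }
  assert (W : alpha / b < eps).
  { apply Rmult_lt_reg_r with b; [lra|].
    replace (alpha / b * b) with (alpha / eps * eps) by (field; lra).
    rewrite (Rmult_comm eps); apply Rmult_lt_compat_r; lra. }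
  rewrite Cmod_minus_sym, <- RtoC_minus, Cmod_RtoC_pos; lra.
Qed.

(** The Euler integrand [x^(z-1) e^(-wx)] as a single exponential: moduli, products and derivatives
    reduce to linear algebra in the exponent. *)
Definition gamma_kernel (z w : C) (x : R) : C := Cexp ((z - 1) * ln x - w * x)%C.

Lemma Cmod_gamma_kernel (z w : C) (x : R) :
  Cmod (gamma_kernel z w x) = exp ((Re z - 1) * ln x - Re w * x).
Proof.
unfold gamma_kernel; rewrite Cmod_Cexp; f_equal; unfold Re; simpl; ring.
Qed.

Lemma gamma_kernel_RtoC (z w x : R) :
  gamma_kernel z w x = RtoC (exp ((z - 1) * ln x - w * x)).
Proof.
unfold gamma_kernel; rewrite <- !RtoC_minus, <- !RtoC_mult, <- !RtoC_minus.
unfold Cexp; simpl; rewrite cos_0, sin_0; apply injective_projections; simpl; ring.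
Qed.

Ltac solve_Ccont := lazymatch goal with
  | |- continuous (fun _ => Cexp _) _ => apply continuous_Cexp; solve_Ccont
  | |- continuous (fun _ => Cmult _ _) _ => apply continuous_Cmult; solve_Ccont
  | |- continuous (fun _ => Cplus _ _) _ => apply continuous_Cplus; solve_Ccont
  | |- continuous (fun _ => Copp _) _ => apply continuous_Copp; solve_Ccont
  | |- continuous (fun _ => ?c) _ => exact (continuous_const c _)
  | |- continuous (fun _ => RtoC _) _ => apply continuous_RtoC; solve_Ccont
  | |- continuous (fun _ => ln _) _ => apply continuous_ln_comp; solve_Ccont
  | |- continuous (fun y => y) _ => apply continuous_id
  | |- continuous (fun y => fst y) _ => apply continuous_fst
  | |- continuous (fun y => snd y) _ => apply continuous_snd
  | |- continuous RtoC _ => apply (continuous_RtoC (fun y => y)), continuous_id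
  | |- continuous ln _ => apply continuous_ln; solve_Ccont
  | |- continuous fst _ => apply continuous_fst
  | |- continuous snd _ => apply continuous_snd
  | |- _ => try assumption
  end.

Lemma continuous_gamma_kernel (z w : C) (x : R) :
  0 < x -> continuous (gamma_kernel z w) x.
Proof. intros Hx; unfold gamma_kernel, Cminus; solve_Ccont. Qed.

Lemma ex_is_CRInt_0_infty_power_exp (f : R -> C) (alpha kappa K : R) :
  0 < alpha -> 0 < kappa ->
  (forall x, 0 < x -> continuous f x) ->
  (forall x, 0 < x -> Cmod (f x) <= K * exp ((alpha - 1) * ln x - kappa * x)) ->
  exists l, is_CRInt_0_infty f l.
Proof.
intros Ha Hk Hf H.
(* The dominator equals [alpha x^(alpha-1) (1 + x)^(-alpha-1)], so it remains to bound
   [(1 + x)^(alpha+1) e^(-kappa x)]. The tangent of [ln] with this slope, at [1 + x], cancels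
   [kappa x] and leaves the constant [alpha * A]. *)
set (c := kappa / (alpha + 1)).
assert (Hc : 0 < c) by (apply Rdiv_lt_0_compat; lra).
set (A := exp (kappa - (alpha + 1) * (1 + ln c) - ln alpha)).
apply (ex_is_CRInt_0_infty f _ _ Hf) with
  (2 := is_CRInt_0_infty_Cmult (RtoC (K * A)) _ _ (is_CRInt_0_infty_dominator alpha Ha)).
intros x Hx; rewrite <- RtoC_mult; simpl.
assert (K0 : 0 <= K).
{ assert (G := Rle_trans _ _ _ (Cmod_ge_0 _) (H x Hx)).
  pose proof (exp_pos ((alpha - 1) * ln x - kappa * x)); nra. }
apply Rle_trans with (1 := H x Hx).
rewrite Rmult_assoc; apply Rmult_le_compat_l; [exact K0|].
replace (alpha * (/ x - / (1 + x))) with (exp (ln alpha - ln x - ln (1 + x))).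
2: { unfold Rminus; rewrite !exp_plus, !exp_Ropp, !exp_ln by lra; field; lra. }
unfold A; rewrite <- !exp_plus; apply exp_le_compat.
assert (L := ln_le_linear c (1 + x) Hc ltac:(lra)).
apply (Rmult_le_compat_l (alpha + 1)) in L; [|lra].
assert (E : (alpha + 1) * (c * (1 + x)) = kappa * (1 + x)) by (unfold c; field; lra).
lra.
Qed.

Lemma ex_gamma_kernel (z w : C) : 0 < Re z -> 0 < Re w ->
  exists l, is_CRInt_0_infty (gamma_kernel z w) l.
Proof.
intros Hz Hw.
apply (ex_is_CRInt_0_infty_power_exp _ (Re z) (Re w) 1 Hz Hw).
- intros x Hx; apply continuous_gamma_kernel, Hx.
- intros x Hx; rewrite Cmod_gamma_kernel; lra.
Qed.

(** [CGamma] is a value of a total operator and carries information only once its integral is known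
    to converge. *)
Lemma is_CRInt_0_infty_CGamma (z : C) : 0 < Re z ->
  is_CRInt_0_infty (gamma_kernel z 1) (CGamma z).
Proof.
intros Hz.
destruct (ex_gamma_kernel z 1 Hz) as [l Hl]; [simpl; lra|].
assert (E : CGamma z = l); [|rewrite E; exact Hl].
apply is_CRInt_0_infty_unique.
apply is_CRInt_0_infty_ext with (2 := Hl); intros x Hx.
unfold gamma_kernel, Rcpow; rewrite <- Cexp_plus; f_equal; ring.
Qed.

Lemma Cmod_le_abs (z : C) : Cmod z <= Rabs (fst z) + Rabs (snd z).
Proof.
unfold Cmod; apply Rsqr_incr_0_var.
- rewrite Rsqr_sqrt by nra; unfold Rsqr.
  assert (H1 := Rabs_pos (fst z)); assert (H2 := Rabs_pos (snd z)).
  rewrite <- (pow2_abs (fst z)), <- (pow2_abs (snd z)); nra.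
- assert (H1 := Rabs_pos (fst z)); assert (H2 := Rabs_pos (snd z)); lra.
Qed.

Section Rotation.
Variables s w : C.

(** [phi t] is the pullback of [z^(s-1) e^(-z) dz] to the ray [z = e^(t w) x]; [chi t x] is
    [x * phi t x] for [x > 0]. The common value [psi] of the [t]-derivative of [phi] and the
    [x]-derivative of [w * chi] expresses that the form is closed. *)
Let phi (t x : R) : C := Cexp ((s - 1) * ln x + t * (s * w) - Cexp (t * w) * x)%C.
Let chi (t x : R) : C := Cexp (s * ln x + t * (s * w) - Cexp (t * w) * x)%C.
Let psi (t x : R) : C := ((s * w - w * Cexp (t * w) * x) * phi t x)%C.

Lemma is_derive_linear_C (c : C) (t : R) :
  is_derive (V := C_R_NormedModule) (fun u : R => (u * c)%C) t c.
Proof.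
apply is_derive_C_pair; simpl; auto_derive; auto; ring.
Qed.

Lemma is_derive_phi (t x : R) :
  is_derive (V := C_R_NormedModule) (fun u => phi u x) t (psi t x).
Proof.
unfold phi, psi; apply is_derive_Cexp.
assert (H := is_derive_Cmult _ _ t _ _ (is_derive_Cexp _ t _ (is_derive_linear_C w t))
  (is_derive_const (V := C_R_NormedModule) (RtoC x) t)).
assert (H' := is_derive_minus (V := C_R_NormedModule) _ _ t _ _
  (is_derive_plus (V := C_R_NormedModule) _ _ t _ _
    (is_derive_const (V := C_R_NormedModule) ((s - 1) * ln x)%C t)
    (is_derive_linear_C (s * w) t)) H).
refine (eq_ind _ (is_derive _ t) H' _ _).
change ((0 + s * w) - (w * Cexp (t * w) * x + Cexp (t * w) * 0)
  = s * w - w * Cexp (t * w) * x)%C; ring.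
Qed.

Lemma is_derive_chi (t x : R) : 0 < x ->
  is_derive (V := C_R_NormedModule) (fun y => w * chi t y)%C x (psi t x).
Proof.
intros Hx.
assert (E : psi t x = (0 * chi t x + w * ((/ x * s - Cexp (t * w)) * chi t x))%C).
{ unfold psi, chi.
  replace (s * ln x + t * (s * w) - Cexp (t * w) * x)%C
    with (ln x + ((s - 1) * ln x + t * (s * w) - Cexp (t * w) * x))%C by ring.
  rewrite (Cexp_plus (ln x)); fold (phi t x).
  replace (Cexp (ln x)) with (RtoC x).
  2: { unfold Cexp; simpl; rewrite exp_ln, cos_0, sin_0 by exact Hx.
       apply injective_projections; simpl; ring. }
  field; intros H; apply RtoC_inj in H; lra. }
rewrite E; apply is_derive_Cmult.
{ apply (is_derive_const (V := C_R_NormedModule)). }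
apply is_derive_Cexp.
assert (H1 : is_derive (V := C_R_NormedModule) (fun y => s * ln y)%C x (/ x * s)%C).
{ rewrite <- RtoC_inv by lra; apply is_derive_C_pair; simpl; auto_derive; auto; ring. }
assert (H2 : is_derive (V := C_R_NormedModule) (fun y : R => Cexp (t * w) * y)%C x
  (Cexp (t * w))).
{ apply is_derive_C_pair; simpl; auto_derive; auto; unfold Re, Im; simpl; ring. }
assert (H := is_derive_minus (V := C_R_NormedModule) _ _ x _ _
  (is_derive_plus (V := C_R_NormedModule) _ _ x _ _ H1
    (is_derive_const (V := C_R_NormedModule) (t * (s * w))%C x)) H2).
refine (eq_ind _ (is_derive _ x) H _ _).
change ((/ x * s + 0) - Cexp (t * w) = / x * s - Cexp (t * w))%C; ring.
Qed.

Lemma continuous_psi (t x : R) : 0 < x ->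
  continuous (U := prod_UniformSpace R_UniformSpace R_UniformSpace)
    (fun p : R * R => psi (fst p) (snd p)) (t, x).
Proof. intros Hx; unfold psi, phi, Cminus; solve_Ccont. Qed.

Lemma continuous_phi_r (t x : R) : 0 < x -> continuous (phi t) x.
Proof. intros Hx; unfold phi, Cminus; solve_Ccont. Qed.

Lemma continuous_psi_r (t x : R) : 0 < x -> continuous (psi t) x.
Proof. intros Hx; unfold psi, phi, Cminus; solve_Ccont. Qed.

(** Differentiation under the integral sign and the mean value bound are applied to real functions;
    the projection [pr] is abstract so that [fst] and [snd] share the argument. *)
Lemma RInt_component_variation (pr : C -> R) (a b D : R) :
  (forall (f : R -> C) x l, is_derive (V := C_R_NormedModule) f x l ->
     is_derive (fun t => pr (f t)) x (pr l)) ->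
  (forall (U : UniformSpace) (f : U -> C) x, continuous f x ->
     continuous (fun y => pr (f y)) x) ->
  (forall f a b l, is_CRInt f a b l -> is_RInt (fun x => pr (f x)) a b (pr l)) ->
  (forall z, Rabs (pr z) <= Cmod z) ->
  0 < a < b ->
  (forall t, Rabs t <= 1 -> Cmod (w * chi t b - w * chi t a) <= D) ->
  Rabs (RInt (fun x => pr (phi 1 x)) a b - RInt (fun x => pr (phi 0 x)) a b) <= D.
Proof.
intros Pd Pc Pi Pm Hab HD.
assert (G : forall t, is_derive (fun t => RInt (fun x => pr (phi t x)) a b) t
  (pr (w * chi t b - w * chi t a)%C)).
{ intros t.
  assert (E : RInt (fun x => Derive (fun u => pr (phi u x)) t) a b
    = pr (w * chi t b - w * chi t a)%C).
  { apply is_RInt_unique.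
    apply (is_RInt_ext (fun x => pr (psi t x))).
    { intros x _; symmetry; apply is_derive_unique, Pd, is_derive_phi. }
    apply Pi.
    apply (is_RInt_derive (V := C_R_CompleteNormedModule) (fun y => w * chi t y)%C);
      intros x; rewrite Rmin_left by lra; intros Hx;
      [apply is_derive_chi|apply continuous_psi_r]; lra. }
  rewrite <- E; apply (is_derive_RInt_param (fun t x => pr (phi t x))).
  - apply filter_forall; intros u x _; eexists; apply Pd, is_derive_phi.
  - intros x; rewrite Rmin_left by lra; intros Hx.
    apply (continuity_2d_pt_ext (fun u x => pr (psi u x))).
    { intros u y; symmetry; apply is_derive_unique, Pd, is_derive_phi. }
    apply continuity_2d_pt_filterlim.
    exact (Pc (prod_UniformSpace R_UniformSpace R_UniformSpace)
      (fun p : R * R => psi (fst p) (snd p)) (t, x) (continuous_psi t x ltac:(lra))).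
  - apply filter_forall; intros u.
    apply (ex_RInt_continuous (V := R_CompleteNormedModule)).
    intros x; rewrite Rmin_left by lra; intros Hx.
    exact (Pc R_UniformSpace (phi u) x (continuous_phi_r u x ltac:(lra))). }
(* [bounded_variation] wants the derivative bound wherever [|t - 0| <= |1 - 0|], which is why the
   hypothesis on [chi] also covers negative [t]. *)
replace D with (D * Rabs (1 - 0)) by (rewrite Rabs_pos_eq; lra).
apply (bounded_variation (fun t => RInt (fun x => pr (phi t x)) a b)
  (fun t => pr (w * chi t b - w * chi t a)%C)).
intros t Ht; split; [apply G|].
apply Rle_trans with (1 := Pm _), HD.
rewrite Rminus_0_r in Ht; rewrite (Rabs_pos_eq (1 - 0)) in Ht; lra.
Qed.

Lemma is_CRInt_phi_variation (a b D : R) (l0 l1 : C) :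
  0 < a < b ->
  (forall t, Rabs t <= 1 -> Cmod (w * chi t b - w * chi t a) <= D) ->
  is_CRInt (phi 0) a b l0 -> is_CRInt (phi 1) a b l1 -> Cmod (l1 - l0) <= 2 * D.
Proof.
intros Hab HD H0 H1.
apply Rle_trans with (1 := Cmod_le_abs _).
assert (F := is_RInt_fct_extend_fst (U := R_NormedModule) (V := R_NormedModule)).
assert (S := is_RInt_fct_extend_snd (U := R_NormedModule) (V := R_NormedModule)).
assert (K1 := RInt_component_variation fst a b D is_derive_C_fst
  (@continuous_C_fst) F (fun z => Rle_trans _ _ _ (Rmax_l _ _) (Rmax_Cmod z)) Hab HD).
assert (K2 := RInt_component_variation snd a b D is_derive_C_snd
  (@continuous_C_snd) S (fun z => Rle_trans _ _ _ (Rmax_r _ _) (Rmax_Cmod z)) Hab HD).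
assert (F0 : RInt (fun x => fst (phi 0 x)) a b = fst l0)
  by exact (is_RInt_unique _ _ _ _ (F _ _ _ _ H0)).
assert (F1 : RInt (fun x => fst (phi 1 x)) a b = fst l1)
  by exact (is_RInt_unique _ _ _ _ (F _ _ _ _ H1)).
assert (S0 : RInt (fun x => snd (phi 0 x)) a b = snd l0)
  by exact (is_RInt_unique _ _ _ _ (S _ _ _ _ H0)).
assert (S1 : RInt (fun x => snd (phi 1 x)) a b = snd l1)
  by exact (is_RInt_unique _ _ _ _ (S _ _ _ _ H1)).
rewrite F0, F1 in K1; rewrite S0, S1 in K2.
change (fst (l1 - l0)%C) with (fst l1 - fst l0).
change (snd (l1 - l0)%C) with (snd l1 - snd l0).
lra.
Qed.

(** For [|t| <= 1] the real part of [e^(t w)] is at least [e^(-|Re w|) cos (Im w)], positive since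
    [|Im w| < PI / 2]: the decay in [x] is uniform along the whole path. *)
Lemma Cmod_chi_le (t x : R) : Rabs (Im w) < PI / 2 -> Rabs t <= 1 -> 0 < x ->
  Cmod (chi t x) <= exp (Rabs (Re (s * w)))
    * exp (Re s * ln x - exp (- Rabs (Re w)) * cos (Im w) * x).
Proof.
intros Hw Ht Hx; unfold chi.
rewrite Cmod_Cexp, <- exp_plus; apply exp_le_compat.
replace (Re (s * ln x + t * (s * w) - Cexp (t * w) * x))%C
  with (Re s * ln x + t * Re (s * w)%C - exp (t * Re w) * cos (t * Im w) * x).
2: { unfold Cexp, Re, Im; simpl; rewrite !Rmult_0_l, !Rminus_0_r, !Rplus_0_r; ring. }
assert (B1 : t * Re (s * w)%C <= Rabs (Re (s * w)%C)).
{ apply Rle_trans with (1 := Rle_abs _); rewrite Rabs_mult.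
  assert (P := Rabs_pos (Re (s * w)%C)); nra. }
assert (B2 : exp (- Rabs (Re w)) <= exp (t * Re w)).
{ apply exp_le_compat; apply Rle_trans with (- Rabs (t * Re w)).
  - rewrite Rabs_mult; assert (P := Rabs_pos (Re w)); nra.
  - assert (Q := Rle_abs (- (t * Re w))); rewrite Rabs_Ropp in Q; lra. }
assert (Ce : forall y, cos y = cos (Rabs y)).
{ intros y; unfold Rabs; destruct (Rcase_abs y); [rewrite cos_neg|]; reflexivity. }
assert (Pv := Rabs_pos (Im w)).
assert (B3 : cos (Im w) <= cos (t * Im w)).
{ rewrite (Ce (Im w)), (Ce (t * Im w)), Rabs_mult.
  assert (P := Rabs_pos t).
  apply cos_decr_1; nra. }
assert (B4 : 0 < cos (Im w)) by (rewrite Ce; apply cos_gt_0; lra).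
assert (P1 := exp_pos (- Rabs (Re w))).
assert (B5 : exp (- Rabs (Re w)) * cos (Im w) <= exp (t * Re w) * cos (t * Im w))
  by (apply Rmult_le_compat; lra).
apply (Rmult_le_compat_r x) in B5; lra.
Qed.

(* Along [t |-> exp (t w)] the integral of [x^(s-1) e^(- e^(t w) x)], multiplied by
   [e^(t s w)], does not depend on [t]: the [t]-derivative of the integrand is
   the [x]-derivative of [w x^s e^(t s w - e^(t w) x)], which vanishes at both ends. *)
Lemma is_CRInt_0_infty_gamma_kernel :
  0 < Re s -> Rabs (Im w) < PI / 2 ->
  is_CRInt_0_infty (gamma_kernel s (Cexp w)) (CGamma s * Cexp (- (s * w)))%C.
Proof.
intros Hs Hw.
assert (Hphi0 : forall x, gamma_kernel s 1 x = phi 0 x).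
{ intros x; unfold gamma_kernel, phi; rewrite !Cmult_0_l, Cexp_0; f_equal; ring. }
assert (Hphi1 : forall x, gamma_kernel s (Cexp w) x = (Cexp (- (s * w)) * phi 1 x)%C).
{ intros x; unfold gamma_kernel, phi; rewrite !Cmult_1_l, <- Cexp_plus; f_equal; ring. }
assert (H : is_CRInt_0_infty (phi 1) (CGamma s)).
2: { rewrite Cmult_comm.
  apply is_CRInt_0_infty_ext with (2 := is_CRInt_0_infty_Cmult _ _ _ H).
  intros x _; symmetry; apply Hphi1. }
set (beta := exp (- Rabs (Re w)) * cos (Im w)).
assert (Hb : 0 < beta).
{ apply Rmult_lt_0_compat; [apply exp_pos|].
  apply Rabs_def2 in Hw; apply cos_gt_0; lra. }
set (A := exp (Rabs (Re (s * w)))).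
assert (HA : 0 < A) by apply exp_pos.
assert (Gs := proj1 (is_CRInt_0_infty_eps _ _) (is_CRInt_0_infty_CGamma s Hs)).
apply is_CRInt_0_infty_eps; intros eps He.
destruct (Gs (eps / 2)) as [d [M [Hd HM]]]; [lra|].
(* The [1] keeps [W] positive when [w = 0]. With [e1] below, each boundary term is at most
   [W * A * e1 = eps / 8], so [D = eps / 4], and the two components together move the integral by at
   most [eps / 2]. *)
set (W := Cmod w + 1).
assert (HW : 0 < W) by (unfold W; pose proof (Cmod_ge_0 w); lra).
assert (HWA : 0 < W * A) by (apply Rmult_lt_0_compat; assumption).
set (e1 := eps / (8 * (W * A))).
assert (He1 : 0 < e1) by (apply Rdiv_lt_0_compat; lra).
destruct (exp_mult_ln_small (Re s) e1 Hs He1) as [d1 [Hd1 Sm]].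
destruct (exp_power_exp_large (Re s) beta e1 Hs Hb He1) as [M1 [HM1 La]].
assert (I1 := Rmin_l d d1); assert (I2 := Rmin_r d d1).
assert (I3 := Rmax_l M M1); assert (I4 := Rmax_r M M1).
exists (Rmin d d1), (Rmax M M1); split.
{ split; [apply Rmin_glb_lt; lra|lra]. }
intros a b Ha Hbb.
destruct (HM a b) as [y [Hy1 Hy2]]; [lra|lra|].
destruct (ex_is_CRInt (phi 1) a b) as [l Hl]; [lra|lra|apply continuous_phi_r|].
exists l; split; [exact Hl|].
assert (V : Cmod (l - y) <= 2 * (eps / 4)).
{ apply (is_CRInt_phi_variation a b (eps / 4)); [lra| |
    apply (is_RInt_ext (V := C_R_NormedModule)) with (2 := Hy1); intros; apply Hphi0
    |exact Hl].
  intros t Ht.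
  apply Rle_trans with (1 := Cmod_triangle _ _); rewrite Cmod_opp, !Cmod_mult.
  assert (X1 := Cmod_chi_le t a Hw Ht ltac:(lra)); fold beta A in X1.
  assert (X2 := Cmod_chi_le t b Hw Ht ltac:(lra)); fold beta A in X2.
  assert (Y2 := La b ltac:(lra)).
  assert (Y1 : exp (Re s * ln a - beta * a) < e1).
  { apply Rle_lt_trans with (2 := Sm a ltac:(lra)), exp_le_compat; nra. }
  assert (Z : forall u v, u <= A * v -> v < e1 -> 0 <= u -> Cmod w * u <= eps / 8).
  { intros u v Hu Hv Hu0.
    replace (eps / 8) with (W * (A * e1)) by (unfold e1; field; lra).
    apply Rmult_le_compat; [apply Cmod_ge_0|exact Hu0|unfold W; lra|nra]. }
  assert (Z1 := Z _ _ X1 Y1 (Cmod_ge_0 _)); assert (Z2 := Z _ _ X2 Y2 (Cmod_ge_0 _)).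
  lra. }
replace (l - CGamma s)%C with ((l - y) + (y - CGamma s))%C by ring.
apply Rle_lt_trans with (1 := Cmod_triangle _ _); lra.
Qed.

End Rotation.

(** * Nonvanishing of Gamma *)

Lemma Re_RtoC_mult (r : R) (z : C) : Re (r * z) = r * Re z.
Proof. unfold Re; simpl; ring. Qed.

(** Integration by parts: [z x^(z-1) e^(-x) - x^z e^(-x)] is the derivative of [x^z e^(-x)], that is
    of [gamma_kernel (z + 1) 1], which vanishes at both ends. *)
Lemma CGamma_succ (z : C) : 0 < Re z -> CGamma (z + 1) = (z * CGamma z)%C.
Proof.
intros Hz.
assert (E : forall x, 0 < x -> gamma_kernel (z + 1) 1 x = (x * gamma_kernel z 1 x)%C).
{ intros x Hx; unfold gamma_kernel.
  replace ((z + 1 - 1) * ln x - 1 * x)%C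
    with (ln x + ((z - 1) * ln x - 1 * x))%C by ring.
  rewrite Cexp_plus; f_equal.
  unfold Cexp; simpl; rewrite exp_ln, cos_0, sin_0 by exact Hx.
  apply injective_projections; simpl; ring. }
assert (Hz1 : 0 < Re (z + 1)) by (unfold Re in *; simpl; lra).
assert (H1 := is_CRInt_0_infty_minus _ _ _ _
  (is_CRInt_0_infty_Cmult z _ _ (is_CRInt_0_infty_CGamma z Hz))
  (is_CRInt_0_infty_CGamma (z + 1) Hz1)).
assert (M : forall x, Cmod (gamma_kernel (z + 1) 1 x) = exp (Re z * ln x - 1 * x)).
{ intros x; rewrite Cmod_gamma_kernel; f_equal; unfold Re; simpl; ring. }
assert (H2 : is_CRInt_0_infty
  (fun x => z * gamma_kernel z 1 x - gamma_kernel (z + 1) 1 x)%C (0 - 0)%C).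
{ apply (is_CRInt_0_infty_derive (gamma_kernel (z + 1) 1)).
  - intros x Hx.
    replace (z * gamma_kernel z 1 x - gamma_kernel (z + 1) 1 x)%C
      with ((/ x * z - 1) * gamma_kernel (z + 1) 1 x)%C.
    2: { rewrite E by exact Hx; field; intros H; apply RtoC_inj in H; lra. }
    apply is_derive_Cexp; rewrite <- RtoC_inv by lra.
    apply is_derive_C_pair; simpl; auto_derive; auto; ring.
  - intros x Hx; unfold Cminus; apply continuous_Cplus.
    + apply continuous_Cmult; [apply continuous_const|apply continuous_gamma_kernel, Hx].
    + apply continuous_Copp, continuous_gamma_kernel, Hx.
  - intros eps He; destruct (exp_mult_ln_small (Re z) eps Hz He) as [d [Hd H]].
    exists d; split; [exact Hd|]; intros a Ha.
    replace (_ - 0)%C with (gamma_kernel (z + 1) 1 a) by ring; rewrite M.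
    apply Rle_lt_trans with (2 := H a Ha), exp_le_compat; lra.
  - intros eps He; destruct (exp_power_exp_large (Re z) 1 eps Hz Rlt_0_1 He) as [N [_ H]].
    exists N; intros b Hb.
    replace (_ - 0)%C with (gamma_kernel (z + 1) 1 b) by ring; rewrite M.
    exact (H b Hb). }
assert (E2 : (z * CGamma z - CGamma (z + 1))%C = (0 - 0)%C).
{ rewrite <- (is_CRInt_0_infty_unique _ _ H1); apply is_CRInt_0_infty_unique, H2. }
transitivity (z * CGamma z - (z * CGamma z - CGamma (z + 1)))%C; [ring|].
rewrite E2; ring.
Qed.

(* [x^(a-1) e^(-x)] dominates [/ a] times the derivative of [(1 - e^(-x))^a]. *)
Lemma CGamma_real_pos (a : R) : 1 <= a -> 0 < Re (CGamma a).
Proof.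
intros Ha.
set (F := fun x => exp (a * ln (1 - exp (- x)))).
set (f := fun x => a * exp ((a - 1) * ln (1 - exp (- x)) - x)).
assert (P : forall x, 0 < x -> 0 < 1 - exp (- x)).
{ intros x Hx; assert (exp (- x) < exp 0) by (apply exp_increasing; lra).
  rewrite exp_0 in H; lra. }
assert (L : forall x, 0 < x -> ln (1 - exp (- x)) <= ln x).
{ intros x Hx; assert (H := exp_ineq1_le (- x)).
  apply ln_le; [apply P, Hx|lra]. }
assert (H : is_CRInt_0_infty (fun x => RtoC (f x)) (1 - 0)%C).
{ apply (is_CRInt_0_infty_derive (fun x => RtoC (F x))).
  - intros x Hx; apply is_derive_RtoC; unfold F, f.
    assert (Px := P x Hx).
    auto_derive; [exact Px|].
    replace ((a - 1) * ln (1 - exp (- x)) - x)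
      with (a * ln (1 - exp (- x)) + (- ln (1 - exp (- x)) + - x)) by ring.
    rewrite !exp_plus, (exp_Ropp (ln _)), exp_ln by exact Px.
    unfold Rminus, Rdiv; ring.
  - intros x Hx; apply continuous_RtoC, (ex_derive_continuous (V := R_NormedModule)).
    assert (Px := P x Hx); unfold f; auto_derive; exact Px.
  - intros eps He; destruct (exp_mult_ln_small a eps ltac:(lra) He) as [d [Hd H]].
    exists d; split; [exact Hd|]; intros x Hx.
    replace (_ - 0)%C with (RtoC (F x)) by ring.
    rewrite Cmod_RtoC_pos by (left; apply exp_pos).
    apply Rle_lt_trans with (2 := H x Hx), exp_le_compat.
    apply Rmult_le_compat_l; [lra|apply L; lra].
  - intros eps He.
    (* For [v <= 1/2] one has [ln (1 - v) >= - 2 v], hence [(1 - v)^a >= 1 - 2 a v]; the second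
       bound makes the loss [2 a v] smaller than [eps]. *)
    set (v0 := Rmin (1 / 2) (eps / (2 * a))).
    assert (V1 := Rmin_l (1 / 2) (eps / (2 * a))); fold v0 in V1.
    assert (V2 := Rmin_r (1 / 2) (eps / (2 * a))); fold v0 in V2.
    assert (V0 : 0 < v0) by (apply Rmin_glb_lt; [lra|apply Rdiv_lt_0_compat; lra]).
    exists (Rmax 0 (- ln v0)); intros x Hx.
    assert (M1 := Rmax_l 0 (- ln v0)); assert (M2 := Rmax_r 0 (- ln v0)).
    assert (Hv : exp (- x) < v0).
    { apply Rlt_le_trans with (exp (ln v0)).
      - apply exp_increasing; lra.
      - rewrite exp_ln by exact V0; lra. }
    set (v := exp (- x)) in *.
    assert (Hv0 : 0 < v) by apply exp_pos.
    assert (LN : - (2 * v) <= ln (1 - v)).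
    { assert (K := ln_le_linear 1 (/ (1 - v)) Rlt_0_1 ltac:(apply Rinv_0_lt_compat; lra)).
      rewrite ln_Rinv, ln_1 in K by lra.
      assert (/ (1 - v) <= 1 + 2 * v).
      { apply Rmult_le_reg_l with (1 - v); [lra|].
        rewrite Rinv_r by lra; nra. }
      lra. }
    assert (LN' : ln (1 - v) < 0).
    { rewrite <- ln_1; apply ln_increasing; lra. }
    assert (U : F x < 1).
    { unfold F; fold v; apply Rlt_le_trans with (exp 0);
        [apply exp_increasing; nra|rewrite exp_0; lra]. }
    assert (V : 1 - 2 * a * v <= F x).
    { unfold F; fold v; apply Rle_trans with (2 := exp_ineq1_le _); nra. }
    assert (W : 2 * a * v < eps).
    { apply Rlt_le_trans with (2 * a * (eps / (2 * a))).
      - apply Rmult_lt_compat_l; lra.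
      - apply Req_le; field; lra. }
    rewrite Cmod_minus_sym, <- RtoC_minus, Cmod_RtoC_pos; lra. }
assert (B : forall x, 0 < x -> Cmod (f x) <= Re (a * gamma_kernel a 1 x)%C).
{ intros x Hx; rewrite gamma_kernel_RtoC, <- RtoC_mult.
  unfold f; rewrite Cmod_RtoC_pos.
  2: { apply Rmult_le_pos; [lra|left; apply exp_pos]. }
  apply Rmult_le_compat_l; [lra|]; apply exp_le_compat.
  assert (K := L x Hx).
  assert ((a - 1) * ln (1 - exp (- x)) <= (a - 1) * ln x)
    by (apply Rmult_le_compat_l; lra).
  simpl; lra. }
assert (K := Cmod_is_CRInt_0_infty_le _ _ _ _ B H
  (is_CRInt_0_infty_Cmult a _ _ (is_CRInt_0_infty_CGamma a ltac:(simpl; lra)))).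
replace (1 - 0)%C with (RtoC 1) in K by ring.
rewrite Cmod_1 in K.
rewrite Re_RtoC_mult in K.
destruct (Rlt_dec 0 (Re (CGamma a))) as [G|G]; [exact G|].
assert (a * Re (CGamma a) <= a * 0) by (apply Rmult_le_compat_l; lra); lra.
Qed.

Lemma Rabs_sin_le (x : R) : Rabs (sin x) <= Rabs x.
Proof.
assert (H : forall y, 0 <= y -> Rabs (sin y) <= y).
{ intros y [Hy|Hy].
  2: { rewrite <- Hy, sin_0, Rabs_R0; lra. }
  apply Rabs_le; split; [|left; apply sin_lt_x, Hy].
  destruct (Rle_dec y 1) as [H1|H1].
  - assert (PI2 := PI2_1); assert (0 <= sin y) by (apply sin_ge_0; lra); lra.
  - assert (B := SIN_bound y); lra. }
unfold Rabs at 2; destruct (Rcase_abs x) as [Hx|Hx].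
- rewrite <- Rabs_Ropp, <- sin_neg; apply H; lra.
- apply H; lra.
Qed.

(** From [|1 - e^(iy)| <= |y| <= (1 + y^2) / 2]. The quadratic form is what combines with
    [ln_sqr_le] into multiples of [x], [1] and [1 / x], whose Gamma integrals are explicit. *)
Lemma Cmod_1_minus_Cexp_le (y : R) : Cmod (1 - Cexp (Ci * y)) <= (1 + y ^ 2) / 2.
Proof.
assert (Hs := Rabs_sin_le (y / 2)).
assert (E : cos y = 1 - 2 * sin (y / 2) * sin (y / 2)).
{ rewrite <- cos_2a_sin; f_equal; field. }
assert (S : sin (y / 2) * sin (y / 2) <= y ^ 2 / 4).
{ replace (y ^ 2 / 4) with ((y / 2) ^ 2) by field.
  rewrite <- (pow2_abs (y / 2)).
  replace (sin (y / 2) * sin (y / 2)) with (sin (y / 2) ^ 2) by ring.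
  rewrite <- pow2_abs; apply pow_incr; split; [apply Rabs_pos|exact Hs]. }
unfold Cmod; rewrite <- (sqrt_pow2 ((1 + y ^ 2) / 2)) by nra.
apply sqrt_le_1_alt; unfold Cexp; simpl.
replace (0 * y - 1 * 0) with 0 by ring; replace (0 * 0 + 1 * y) with y by ring.
rewrite exp_0.
assert (Q := sin2_cos2 y); unfold Rsqr in Q.
assert (X : 2 - 2 * cos y <= y ^ 2) by (rewrite E; lra).
apply Rle_trans with (1 - 2 * cos y + (sin y * sin y + cos y * cos y));
  [apply Req_le; ring|].
assert (Y := pow2_ge_0 (1 - y ^ 2)); lra.
Qed.

Lemma ln_sqr_le (x : R) : 0 < x -> ln x ^ 2 <= x - 2 + / x.
Proof.
intros Hx.
(* [4 sinh^2 (u / 2) >= u^2] with [u = ln x], through [v = sqrt x]. *)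
set (v := sqrt x).
assert (Hv : 0 < v) by (apply sqrt_lt_R0, Hx).
assert (Ev : x = v * v) by (unfold v; rewrite sqrt_sqrt; lra).
assert (El : ln x = 2 * ln v) by (rewrite Ev, ln_mult by assumption; ring).
(* The difference vanishes at [1] and has derivative [(1 - 1/u)^2]. The case [v < 1] will follow by
   replacing [v] with [1 / v]. *)
assert (G : forall u, 1 <= u -> 2 * ln u <= u - / u).
{ intros u Hu.
  set (h := fun t => t - / t - 2 * ln t).
  destruct (Req_dec u 1) as [->|Hn]; [rewrite ln_1, Rinv_1; lra|].
  destruct (MVT_gen h 1 u (fun t => (1 - / t) ^ 2)) as [c [Hc E]].
  - intros t; rewrite Rmin_left by lra; intros Ht; unfold h.
    auto_derive; [lra|field; lra].
  - intros t; rewrite Rmin_left by lra; intros Ht.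
    apply continuity_pt_filterlim, (ex_derive_continuous (V := R_NormedModule)).
    unfold h; auto_derive; lra.
  - unfold h in E at 2; rewrite ln_1, Rinv_1 in E; unfold h in E.
    assert (0 <= (1 - / c) ^ 2 * (u - 1)) by (apply Rmult_le_pos; [apply pow2_ge_0|lra]).
    lra. }
assert (T : x - 2 + / x = (v - / v) ^ 2) by (rewrite Ev; field; lra).
rewrite T, El.
destruct (Rle_dec 1 v) as [H1|H1].
- assert (H := G v H1).
  assert (0 <= ln v) by (rewrite <- ln_1; apply ln_le; lra).
  apply pow_incr; lra.
- assert (Hi : 1 <= / v) by (rewrite <- Rinv_1; apply Rinv_le_contravar; lra).
  assert (H := G (/ v) Hi).
  rewrite ln_Rinv, Rinv_inv in H by exact Hv.
  assert (ln v < 0) by (rewrite <- ln_1; apply ln_increasing; lra).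
  replace ((2 * ln v) ^ 2) with ((2 * - ln v) ^ 2) by ring.
  replace ((v - / v) ^ 2) with ((/ v - v) ^ 2) by ring.
  apply pow_incr; lra.
Qed.

(* The weight [x^(a-1) e^(-x)] concentrates at [x = a], where
   [x^(iy)] is close to the constant [a^(iy)]. *)
Lemma CGamma_neq_0_large (a y : R) : 2 <= a -> y ^ 2 < a - 1 -> CGamma (a, y) <> 0%C.
Proof.
intros Ha Hy H0.
assert (Za : 0 < Re (RtoC a)) by (simpl; lra).
assert (Gp := CGamma_real_pos a ltac:(lra)).
(* The factor [a^(-iy)] normalises the phase of [x^(iy)] to [1] at [x = a]. *)
set (u := Cexp (- (Ci * (y * ln a)))).
assert (I1 := is_CRInt_0_infty_minus _ _ _ _ (is_CRInt_0_infty_CGamma a Za)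
  (is_CRInt_0_infty_Cmult u _ _ (is_CRInt_0_infty_CGamma (a, y) ltac:(simpl; lra)))).
assert (Zm : 0 < Re (RtoC (a - 1))) by (simpl; lra).
assert (Zp : 0 < Re (RtoC (a + 1))) by (simpl; lra).
assert (Gm : CGamma (RtoC (a - 1)) = (/ RtoC (a - 1) * CGamma a)%C).
{ assert (E := CGamma_succ (RtoC (a - 1)) Zm).
  replace (RtoC (a - 1) + 1)%C with (RtoC a) in E by (rewrite <- RtoC_plus; f_equal; ring).
  rewrite E; field; intros E'; apply RtoC_inj in E'; lra. }
assert (Gs : CGamma (RtoC (a + 1)) = (a * CGamma a)%C).
{ rewrite RtoC_plus; apply CGamma_succ, Za. }
(* With [th = y ln (x / a)] the integrand is off by a factor at most [1/2 + k (x/a - 2 + a/x)].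
   Under the normalised weight [x] has mean [a] and [1 / x] has mean [1 / (a - 1)], so the mean of
   this factor is [1/2 + k / (a - 1)], below [1] exactly when [y^2 < a - 1]. A zero at [a + iy]
   would then give [Gamma(a) < Gamma(a)]. *)
set (k := y ^ 2 / 2).
assert (I2 := is_CRInt_0_infty_plus _ _ _ _
  (is_CRInt_0_infty_Cmult (RtoC (1 / 2 - 2 * k)) _ _ (is_CRInt_0_infty_CGamma a Za))
  (is_CRInt_0_infty_plus _ _ _ _
    (is_CRInt_0_infty_Cmult (RtoC (k / a)) _ _ (is_CRInt_0_infty_CGamma (RtoC (a + 1)) Zp))
    (is_CRInt_0_infty_Cmult (RtoC (k * a)) _ _ (is_CRInt_0_infty_CGamma (RtoC (a - 1)) Zm)))).
assert (B : forall x, 0 < x ->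
  Cmod (gamma_kernel a 1 x - u * gamma_kernel (a, y) 1 x)
  <= Re ((1 / 2 - 2 * k)%R * gamma_kernel a 1 x
     + ((k / a)%R * gamma_kernel (a + 1)%R 1 x + (k * a)%R * gamma_kernel (a - 1)%R 1 x))%C).
{ intros x Hx.
  set (th := y * (ln x - ln a)).
  assert (E : (u * gamma_kernel (a, y) 1 x)%C = (gamma_kernel a 1 x * Cexp (Ci * th))%C).
  { unfold u, gamma_kernel; rewrite <- !Cexp_plus; f_equal; unfold th.
    apply injective_projections; simpl; ring. }
  rewrite E.
  replace (gamma_kernel a 1 x - gamma_kernel a 1 x * Cexp (Ci * th))%C
    with (gamma_kernel a 1 x * (1 - Cexp (Ci * th)))%C by ring.
  rewrite Cmod_mult, !gamma_kernel_RtoC, <- !RtoC_mult, <- !RtoC_plus.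
  rewrite Cmod_RtoC_pos by (left; apply exp_pos).
  change (Re (RtoC ?r)) with r.
  set (g := exp ((a - 1) * ln x - 1 * x)).
  assert (Hg : 0 < g) by apply exp_pos.
  assert (E1 : exp ((a + 1 - 1) * ln x - 1 * x) = x * g).
  { unfold g; rewrite <- (exp_ln x) at 3 by exact Hx; rewrite <- exp_plus; f_equal; ring. }
  assert (E2 : exp ((a - 1 - 1) * ln x - 1 * x) = / x * g).
  { unfold g; rewrite <- (exp_ln x) at 3 by exact Hx; rewrite <- exp_Ropp, <- exp_plus; f_equal; ring. }
  rewrite E1, E2.
  assert (Q := Cmod_1_minus_Cexp_le th).
  assert (L := ln_sqr_le (x / a) ltac:(apply Rdiv_lt_0_compat; lra)).
  rewrite ln_div in L by lra.
  assert (th ^ 2 / 2 <= k * (x / a - 2 + / (x / a))).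
  { unfold th, k. replace ((y * (ln x - ln a)) ^ 2 / 2) with (y ^ 2 / 2 * (ln x - ln a) ^ 2) by field.
    apply Rmult_le_compat_l; [|exact L]; pose proof (pow2_ge_0 y); lra. }
  replace ((1 / 2 - 2 * k) * g + (k / a * (x * g) + k * a * (/ x * g)))
    with (g * (1 / 2 + k * (x / a - 2 + / (x / a)))) by (field; lra).
  apply Rmult_le_compat_l; lra. }
assert (K := Cmod_is_CRInt_0_infty_le _ _ _ _ B I1 I2).
rewrite H0, Gm, Gs, <- RtoC_inv in K by lra.
replace (CGamma a - u * 0)%C with (CGamma a) in K by ring.
assert (K1 := Rle_trans _ _ _ (Re_le_Cmod _) K).
rewrite !Cmult_assoc, <- !RtoC_mult, <- !Cmult_plus_distr_r, <- !RtoC_plus in K1.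
rewrite Re_RtoC_mult in K1.
replace (1 / 2 - 2 * k + (k / a * a + k * a * / (a - 1)))
  with (1 / 2 + k / (a - 1)) in K1 by (field; lra).
assert (k / (a - 1) < 1 / 2).
{ apply Rmult_lt_reg_r with (a - 1); [lra|].
  replace (k / (a - 1) * (a - 1)) with k by (field; lra); unfold k; lra. }
assert ((1 / 2 + k / (a - 1)) * Re (CGamma a) < 1 * Re (CGamma a))
  by (apply Rmult_lt_compat_r; lra). lra.
Qed.

Lemma CGamma_neq_0 (z : C) : 0 < Re z -> CGamma z <> 0%C.
Proof.
intros Hz H0.
assert (Hn : forall n : nat, CGamma (z + INR n) = 0%C).
{ induction n as [|n IH].
  - simpl; rewrite Cplus_0_r; exact H0.
  - rewrite S_INR, RtoC_plus, Cplus_assoc, CGamma_succ, IH; [ring|].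
    assert (P := pos_INR n); unfold Re in *; simpl; lra. }
(* Shifting by [n] raises the real part and keeps the imaginary part. The floor loses less than [1],
   so [n > 2 + (Im z)^2], enough for both bounds on [a]. *)
destruct (nfloor_ex (3 + Im z ^ 2)) as [n Hn']; [pose proof (pow2_ge_0 (Im z)); lra|].
apply (CGamma_neq_0_large (Re z + INR n) (Im z)).
- pose proof (pow2_ge_0 (Im z)); lra.
- lra.
- rewrite <- (Hn n); f_equal; apply injective_projections; simpl; unfold Re, Im; ring.
Qed.

(** * Trapezoidal sums of exponentials *)

(** The centred recursion adds both ends at once, as in the passage from one square to the next. *)
Fixpoint csum (g : Z -> C) (n : nat) : C :=
  match n with
  | O => g 0%Z
  | S m => (csum g m + (g (Z.of_nat n) + g (- Z.of_nat n)%Z))%C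
  end.

(* The sum of [g j] over [|j| <= k] with weight 1/2 at both ends; it is [0] for [k = 0]. *)
Definition trap (g : Z -> C) (k : nat) : C :=
  match k with
  | O => 0%C
  | S m => (csum g m + (g (Z.of_nat k) + g (- Z.of_nat k)%Z) / 2)%C
  end.

(** Rows are counted from [1]; row [0] would be the omitted origin. *)
Fixpoint psum (h : nat -> C) (K : nat) : C :=
  match K with
  | O => 0%C
  | S m => (psum h m + h K)%C
  end.

Lemma csum_ext (g g' : Z -> C) (n : nat) :
  (forall j, (Z.abs j <= Z.of_nat n)%Z -> g j = g' j) -> csum g n = csum g' n.
Proof.
induction n as [|n IH]; intros H; simpl; [apply H; simpl; lia|].
rewrite IH by (intros; apply H; lia).
rewrite !H by lia; reflexivity.
Qed.

Lemma trap_ext (g g' : Z -> C) (n : nat) :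
  (forall j, (Z.abs j <= Z.of_nat n)%Z -> g j = g' j) -> trap g n = trap g' n.
Proof.
destruct n as [|n]; intros H; [reflexivity|]; unfold trap.
rewrite (csum_ext g g') by (intros; apply H; lia).
rewrite !H by lia; reflexivity.
Qed.

Lemma csum_Cmult (c : C) (g : Z -> C) (n : nat) :
  csum (fun j => c * g j)%C n = (c * csum g n)%C.
Proof. induction n as [|n IH]; simpl; [|rewrite IH]; ring. Qed.

Lemma trap_Cmult (c : C) (g : Z -> C) (n : nat) :
  trap (fun j => c * g j)%C n = (c * trap g n)%C.
Proof.
destruct n as [|n]; unfold trap, Cdiv; [|rewrite csum_Cmult]; ring.
Qed.

Lemma csum_plus (g g' : Z -> C) (n : nat) :
  csum (fun j => g j + g' j)%C n = (csum g n + csum g' n)%C.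
Proof. induction n as [|n IH]; simpl; [|rewrite IH]; ring. Qed.

Lemma csum_opp_index (g : Z -> C) (n : nat) :
  csum (fun j => g (- j)%Z) n = csum g n.
Proof.
induction n as [|n IH]; simpl; [reflexivity|rewrite IH].
simpl; ring.
Qed.

Lemma trap_opp_index (g : Z -> C) (n : nat) :
  trap (fun j => g (- j)%Z) n = trap g n.
Proof.
destruct n as [|n]; [reflexivity|]; unfold trap, Cdiv.
rewrite csum_opp_index, Z.opp_involutive; ring.
Qed.

Lemma psum_ext (h h' : nat -> C) (K : nat) :
  (forall k, h k = h' k) -> psum h K = psum h' K.
Proof. intros H; induction K as [|K IH]; simpl; [|rewrite IH, H]; reflexivity. Qed.

Lemma psum_Cmult (c : C) (h : nat -> C) (K : nat) :
  psum (fun k => c * h k)%C K = (c * psum h K)%C.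
Proof. induction K as [|K IH]; simpl; [|rewrite IH]; ring. Qed.

Lemma Cmod_csum_le (g : Z -> C) (n : nat) (B : R) :
  (forall j, (Z.abs j <= Z.of_nat n)%Z -> Cmod (g j) <= B) ->
  Cmod (csum g n) <= (2 * INR n + 1) * B.
Proof.
induction n as [|n IH]; intros H.
- simpl; rewrite Rmult_0_r, Rplus_0_l, Rmult_1_l; apply H; simpl; lia.
- assert (H0 := IH ltac:(intros; apply H; lia)).
  assert (H1 := H (Z.of_nat (S n)) ltac:(lia)).
  assert (H2 := H (- Z.of_nat (S n))%Z ltac:(lia)).
  cbn [csum].
  apply Rle_trans with (1 := Cmod_triangle _ _).
  assert (T := Cmod_triangle (g (Z.of_nat (S n))) (g (- Z.of_nat (S n))%Z)).
  rewrite S_INR; lra.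
Qed.

Lemma Cmod_trap_le (g : Z -> C) (n : nat) (B : R) :
  (forall j, (Z.abs j <= Z.of_nat n)%Z -> Cmod (g j) <= B) ->
  Cmod (trap g n) <= 2 * INR n * B.
Proof.
destruct n as [|n]; intros H.
- simpl; rewrite Cmod_0; lra.
- assert (H0 := Cmod_csum_le g n B ltac:(intros; apply H; lia)).
  assert (H1 := H (Z.of_nat (S n)) ltac:(lia)).
  assert (H2 := H (- Z.of_nat (S n))%Z ltac:(lia)).
  unfold trap.
  apply Rle_trans with (1 := Cmod_triangle _ _).
  assert (T := Cmod_triangle (g (Z.of_nat (S n))) (g (- Z.of_nat (S n))%Z)).
  unfold Cdiv; rewrite Cmod_mult, <- RtoC_inv, (Cmod_RtoC_pos (/ 2)) by lra.
  rewrite S_INR; lra.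
Qed.

Lemma is_CRInt_0_infty_csum (f : Z -> R -> C) (l : Z -> C) (n : nat) :
  (forall j, (Z.abs j <= Z.of_nat n)%Z -> is_CRInt_0_infty (f j) (l j)) ->
  is_CRInt_0_infty (fun x => csum (fun j => f j x) n) (csum l n).
Proof.
induction n as [|n IH]; intros H; cbn [csum].
- apply H; simpl; lia.
- apply is_CRInt_0_infty_plus; [apply IH; intros; apply H; lia|].
  apply is_CRInt_0_infty_plus; apply H; lia.
Qed.

Lemma is_CRInt_0_infty_trap (f : Z -> R -> C) (l : Z -> C) (n : nat) :
  (forall j, (Z.abs j <= Z.of_nat n)%Z -> is_CRInt_0_infty (f j) (l j)) ->
  is_CRInt_0_infty (fun x => trap (fun j => f j x) n) (trap l n).
Proof.
destruct n as [|n]; intros H; unfold trap; [apply is_CRInt_0_infty_zero|].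
apply is_CRInt_0_infty_plus.
- apply is_CRInt_0_infty_csum; intros; apply H; lia.
- unfold Cdiv; rewrite Cmult_comm.
  apply is_CRInt_0_infty_ext with
    (f := fun x => (/ 2 * (f (Z.of_nat (S n)) x + f (- Z.of_nat (S n))%Z x))%C);
    [intros; ring|].
  apply is_CRInt_0_infty_Cmult, is_CRInt_0_infty_plus; apply H; lia.
Qed.

Lemma is_CRInt_0_infty_psum (f : nat -> R -> C) (l : nat -> C) (K : nat) :
  (forall k, is_CRInt_0_infty (f k) (l k)) ->
  is_CRInt_0_infty (fun x => psum (fun k => f k x) K) (psum l K).
Proof.
intros H; induction K as [|K IH]; cbn [psum]; [apply is_CRInt_0_infty_zero|].
apply is_CRInt_0_infty_plus; [exact IH|apply H].
Qed.

Lemma C2_neq_0 : RtoC 2 <> 0%C.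
Proof. intros H; apply RtoC_inj in H; lra. Qed.

Lemma IZR_of_nat_S (n : nat) : IZR (Z.of_nat (S n)) = IZR (Z.of_nat n) + 1.
Proof. rewrite Nat2Z.inj_succ, succ_IZR; reflexivity. Qed.

Section Trapezoid_recurrence.
Variable x : C.

Let e (n : nat) : C := Cexp (IZR (Z.of_nat n) * x)%C.
Let T (k : nat) : C := trap (fun j => Cexp (IZR j * x)%C) k.
Let c (n : nat) : C := (e n + / e n)%C.

Lemma exp_multiple_S (n : nat) : e (S n) = (e n * Cexp x)%C.
Proof.
unfold e; rewrite IZR_of_nat_S, RtoC_plus, <- Cexp_plus; f_equal; ring.
Qed.

Lemma exp_pair_eq (n : nat) :
  (Cexp (IZR (Z.of_nat n) * x) + Cexp (IZR (- Z.of_nat n) * x) = c n)%C.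
Proof.
unfold c, e; rewrite <- Cexp_opp; f_equal; f_equal; rewrite opp_IZR, RtoC_opp; ring.
Qed.

Lemma exp_pair_rec (n : nat) : c (S (S n)) = (2 * Ccosh x * c (S n) - c n)%C.
Proof.
unfold c, Ccosh; rewrite !exp_multiple_S, Cexp_opp; field; repeat split;
  first [apply C2_neq_0 | apply Cexp_neq_0].
Qed.

Lemma exp_multiple_0 : e 0 = 1%C.
Proof. unfold e; simpl; rewrite Cmult_0_l; apply Cexp_0. Qed.

Lemma exp_pair_0 : c 0 = 2%C.
Proof. unfold c; rewrite exp_multiple_0; field; apply C1_nz. Qed.

(** New ends enter with weight 1/2 and the old ends are completed from 1/2 to 1. For [n = 0] the
    term [c 0 / 2 = 1] is the centre itself, consistent with [T 0 = 0]. *)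
Lemma trap_exp_S (n : nat) : T (S n) = (T n + (c (S n) + c n) / 2)%C.
Proof.
unfold T, trap; rewrite exp_pair_eq.
destruct n as [|n].
- cbn [csum]; rewrite Cmult_0_l, Cexp_0, exp_pair_0; field; apply C2_neq_0.
- cbn [csum]; rewrite exp_pair_eq; field; apply C2_neq_0.
Qed.

Lemma trap_exp_1 : T 1 = (2 * Ccosh (x / 2) ^ 2)%C.
Proof.
rewrite trap_exp_S; unfold c; rewrite exp_multiple_S, exp_multiple_0; unfold Ccosh; simpl.
rewrite Cexp_opp.
replace (Cexp x) with (Cexp (x / 2) * Cexp (x / 2))%C.
2: { rewrite <- Cexp_plus; f_equal; field; apply C2_neq_0. }
unfold T, trap; field; repeat split; first [apply C2_neq_0 | apply Cexp_neq_0].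
Qed.

(** Where [sinh (x/2)] is nonzero, [T k] is [sinh (k x) coth (x/2)], so it obeys the recurrence of
    [cosh (k x)]. Working with the recurrence avoids dividing by [sinh (x/2)]. *)
Lemma trap_exp_rec (n : nat) : (T (S (S n)) = 2 * Ccosh x * T (S n) - T n)%C.
Proof.
induction n as [|n IH].
- rewrite !trap_exp_S, (exp_pair_rec 0); unfold c; rewrite exp_multiple_S, exp_multiple_0; unfold T, trap, Ccosh.
  rewrite Cexp_opp; field; repeat split; first [apply C2_neq_0 | apply Cexp_neq_0].
- rewrite (trap_exp_S (S (S n))), IH at 1; rewrite (exp_pair_rec (S n)), (trap_exp_S (S n)).
  rewrite (exp_pair_rec n), (trap_exp_S n).
  field; apply C2_neq_0.
Qed.

(** The truncated generating function of the recurrence: multiplication by the characteristic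
    polynomial telescopes. As [T 0 = 0], the numerator is just [q * T 1], the source of [cosh^2] in
    [f1] and, with an imaginary argument, of [cos^2] in [f2]. The polynomial is kept as a factor
    since it may vanish for general [q]. *)
Lemma psum_geometric (q : C) (K : nat) :
  ((1 - 2 * q * Ccosh x + q ^ 2) * psum (fun k => q ^ k * T k) K
   = q * (2 * Ccosh (x / 2) ^ 2) - q ^ (S K) * T (S K) + q ^ (S (S K)) * T K)%C.
Proof.
rewrite <- trap_exp_1.
induction K as [|K IH].
- cbn [psum]; simpl (q ^ 1)%C; simpl (q ^ 2)%C; unfold T at 3, trap; ring.
- cbn [psum]; rewrite Cmult_plus_distr_l, IH, (trap_exp_rec K).
  rewrite !Cpow_S; ring.
Qed.

End Trapezoid_recurrence.

Lemma geometric_weight_sum (z : R) (K M : nat) : 0 < z < 1 ->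
  sum_n_m (fun k => INR k * z ^ k) (S K) M <= z / (1 - z) ^ 2.
Proof.
intros Hz.
(* The closed form of the partial sum; its last two terms add up to a negative number, which leaves
   the bound by the full series. *)
assert (H : forall n, sum_n (fun k => INR k * z ^ k) n * (1 - z) ^ 2
  = z - (INR n + 1) * z ^ (S n) + INR n * z ^ (S (S n))).
{ induction n as [|n IH].
  - rewrite sum_O; simpl; ring.
  - rewrite sum_Sn; unfold plus; simpl plus.
    change (plus (sum_n (fun k => INR k * z ^ k) n) (INR (S n) * z ^ S n))
      with (sum_n (fun k => INR k * z ^ k) n + INR (S n) * z ^ S n).
    rewrite Rmult_plus_distr_r, IH, S_INR; simpl; ring. }
assert (P : 0 < (1 - z) ^ 2) by (apply pow_lt; lra).
apply Rle_trans with (sum_n (fun k => INR k * z ^ k) M).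
- assert (Q : forall a n, 0 <= sum_n_m (fun k => INR k * z ^ k) a n).
  { intros a n; replace 0 with (sum_n_m (fun _ => 0) a n).
    - apply sum_n_m_le; intros k; apply Rmult_le_pos; [apply pos_INR|apply pow_le; lra].
    - apply (sum_n_m_const_zero (G := R_AbelianMonoid)). }
  destruct (Nat.le_gt_cases (S K) M) as [L|L].
  + unfold sum_n; rewrite (sum_n_m_Chasles _ 0 K M) by lia.
    unfold plus; simpl; assert (Q' := Q 0%nat K); lra.
  + rewrite sum_n_m_zero by lia; apply Q.
- apply Rmult_le_reg_r with (1 := P); rewrite H.
  replace (z / (1 - z) ^ 2 * (1 - z) ^ 2) with z by (field; lra).
  assert (0 < z ^ S M) by (apply pow_lt; lra).
  assert (I := pos_INR M).
  change (z ^ S (S M)) with (z * z ^ S M).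
  assert (INR M * (z * z ^ S M) <= INR M * z ^ S M) by (apply Rmult_le_compat_l; nra).
  lra.
Qed.

(** * Sector sums and their integrals *)

Lemma exp_nat_mult (k : nat) (t : R) : exp (INR k * t) = exp t ^ k.
Proof.
induction k as [|k IH].
- simpl; rewrite Rmult_0_l; apply exp_0.
- rewrite S_INR, Rmult_plus_distr_r, Rmult_1_l, exp_plus, IH; simpl; ring.
Qed.

(** For [z = e^(-mu)] the full series [z / (1 - z)^2] equals [1 / (4 sinh^2 (mu/2))], and
    [ln_sqr_le] at [e^mu] says that [4 sinh^2 (mu/2) >= mu^2]. *)
Lemma geometric_weight_sum_exp (mu : R) (K M : nat) : 0 < mu ->
  sum_n_m (fun k => INR k * exp (- mu) ^ k) (S K) M <= / mu ^ 2.
Proof.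
intros Hmu; set (z := exp (- mu)).
assert (Hz : 0 < z < 1).
{ split; [apply exp_pos|rewrite <- exp_0; apply exp_increasing; lra]. }
apply Rle_trans with (1 := geometric_weight_sum z K M Hz).
assert (L := ln_sqr_le (exp mu) (exp_pos mu)).
rewrite ln_exp, <- exp_Ropp in L; fold z in L.
assert (E : exp mu = / z) by (unfold z; rewrite exp_Ropp, Rinv_inv; reflexivity).
rewrite E in L.
assert (P : 0 < (1 - z) ^ 2) by (apply pow_lt; lra).
assert (Q : 0 < mu ^ 2) by (apply pow_lt; lra).
apply Rmult_le_reg_r with ((1 - z) ^ 2 * mu ^ 2); [apply Rmult_lt_0_compat; assumption|].
replace (z / (1 - z) ^ 2 * ((1 - z) ^ 2 * mu ^ 2)) with (z * mu ^ 2) by (field; lra).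
replace (/ mu ^ 2 * ((1 - z) ^ 2 * mu ^ 2)) with (z * (/ z - 2 + z)) by (field; lra).
apply Rmult_le_compat_l; lra.
Qed.

(** The closed form of the series of [sector_term p r x k] over [k >= 1]: [psum_geometric] at
    [q = e^(-px)] without its boundary terms. *)
Definition sector_summand (p r : C) (x : R) : C :=
  (2 * (Cexp (- (p * x)) * Ccosh (r * x / 2) ^ 2 /
    (1 - 2 * Cexp (- (p * x)) * Ccosh (r * x) + Cexp (- (p * x)) ^ 2)))%C.

Definition sector_term (p r : C) (x : R) (k : nat) : C :=
  trap (fun j => Cexp (- ((INR k * p + IZR j * r) * x)))%C k.

Lemma sector_term_eq (p r : C) (x : R) (k : nat) :
  sector_term p r x k
  = (Cexp (- (p * x)) ^ k * trap (fun j => Cexp (IZR j * (r * x))) k)%C.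
Proof.
unfold sector_term; rewrite <- trap_opp_index, <- trap_Cmult.
apply trap_ext; intros j _.
rewrite <- Cexp_nat_mult, <- Cexp_plus; f_equal.
rewrite opp_IZR, RtoC_opp; ring.
Qed.

Section Sector.
Variables (p r : C) (beta : R).
Hypothesis (Hbeta : 0 < beta) (Hpr : Rabs (Re r) + beta <= Re p).

(** [Hpr] says that even the extreme rays [p + r] and [p - r] have real part at least [beta]; the
    other points of row [k] lie between them. *)
Lemma Re_sector_point (k : nat) (j : Z) : (Z.abs j <= Z.of_nat k)%Z ->
  INR k * beta <= Re (INR k * p + IZR j * r).
Proof.
intros Hj.
replace (Re (INR k * p + IZR j * r)) with (INR k * Re p + IZR j * Re r)
  by (unfold Re; simpl; ring).
assert (H : Rabs (IZR j) <= INR k).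
{ rewrite INR_IZR_INZ, <- abs_IZR; apply IZR_le, Hj. }
assert (H1 : - (Rabs (IZR j) * Rabs (Re r)) <= IZR j * Re r).
{ rewrite <- Rabs_mult; assert (Q := Rle_abs (- (IZR j * Re r))).
  rewrite Rabs_Ropp in Q; lra. }
assert (H2 := Rmult_le_compat_r _ _ _ (Rabs_pos (Re r)) H).
assert (H3 := Rmult_le_compat_l _ _ _ (pos_INR k) Hpr).
lra.
Qed.

(** The trapezoidal weights of row [k] add up to [2 k], and each term is at most [e^(-k beta x)].
    This is split into two equal factors: in a tail, one is bounded by its value on row [K + 1] and
    gives the decay in [K], the other makes the sum over [k] converge. *)
Lemma Cmod_sector_term_le (x : R) (k : nat) : 0 < x ->
  Cmod (sector_term p r x k)
  <= 2 * INR k * (exp (- (beta * x / 2)) ^ k * exp (- (beta * x / 2)) ^ k).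
Proof.
intros Hx; apply Cmod_trap_le; intros j Hj.
rewrite Cmod_Cexp, <- exp_nat_mult, <- exp_plus; apply exp_le_compat.
assert (H := Rmult_le_compat_r x _ _ ltac:(lra) (Re_sector_point k j Hj)).
replace (Re (- ((INR k * p + IZR j * r) * x)))
  with (- (Re (INR k * p + IZR j * r) * x)) by (unfold Re; simpl; ring).
lra.
Qed.

Lemma Cmod_Cexp_neq_1 (z : C) : Re z < 0 -> (1 - Cexp z)%C <> 0%C.
Proof.
intros Hz H.
assert (E : Cexp z = 1%C) by (transitivity (1 - (1 - Cexp z))%C; [|rewrite H]; ring).
apply (f_equal Cmod) in E; rewrite Cmod_Cexp, Cmod_1, <- exp_0 in E.
apply exp_inv in E; lra.
Qed.

(** The denominator is the product of [1 - e^(-(p - r) x)] and [1 - e^(-(p + r) x)], one factor for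
    each extreme ray. *)
Lemma sector_denominator_neq_0 (x : R) : 0 < x ->
  (1 - 2 * Cexp (- (p * x)) * Ccosh (r * x) + Cexp (- (p * x)) ^ 2)%C <> 0%C.
Proof.
intros Hx.
replace (1 - 2 * Cexp (- (p * x)) * Ccosh (r * x) + Cexp (- (p * x)) ^ 2)%C
  with ((1 - Cexp (- (p * x) + r * x)) * (1 - Cexp (- (p * x) + - (r * x))))%C.
2: { rewrite !Cexp_plus; unfold Ccosh; rewrite (Cexp_opp (r * x)).
     field; repeat split; first [apply C2_neq_0 | apply Cexp_neq_0]. }
assert (A1 := Rle_abs (Re r)); assert (A2 := Rle_abs (- Re r)).
rewrite Rabs_Ropp in A2.
assert (P1 : 0 < (Re p - Re r) * x) by (apply Rmult_lt_0_compat; lra).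
assert (P2 : 0 < (Re p + Re r) * x) by (apply Rmult_lt_0_compat; lra).
apply Cmult_neq_0; apply Cmod_Cexp_neq_1; unfold Re in *; simpl; lra.
Qed.

Lemma Cmod_psum_sector_term_le (x : R) (K m : nat) : 0 < x ->
  Cmod (psum (sector_term p r x) (K + m) - psum (sector_term p r x) K)
  <= 2 * exp (- (beta * x / 2)) ^ S K *
     sum_n_m (fun k => INR k * exp (- (beta * x / 2)) ^ k) (S K) (K + m).
Proof.
intros Hx; set (z := exp (- (beta * x / 2))).
assert (Hz : 0 < z < 1).
{ split; [apply exp_pos|rewrite <- exp_0; apply exp_increasing; nra]. }
induction m as [|m IH].
- rewrite Nat.add_0_r, sum_n_m_zero by lia.
  replace (_ - _)%C with (RtoC 0) by ring; rewrite Cmod_0.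
  change (0 <= 2 * z ^ S K * 0); lra.
- rewrite Nat.add_succ_r, sum_n_Sm by lia; cbn [psum].
  change (plus (sum_n_m (fun k => INR k * z ^ k) (S K) (K + m)) (INR (S (K + m)) * z ^ S (K + m)))
    with (sum_n_m (fun k => INR k * z ^ k) (S K) (K + m) + INR (S (K + m)) * z ^ S (K + m)).
  rewrite Rmult_plus_distr_l.
  replace (psum (sector_term p r x) (K + m) + sector_term p r x (S (K + m)) - psum (sector_term p r x) K)%C
    with ((psum (sector_term p r x) (K + m) - psum (sector_term p r x) K)
       + sector_term p r x (S (K + m)))%C by ring.
  apply Rle_trans with (1 := Cmod_triangle _ _), Rplus_le_compat; [exact IH|].
  apply Rle_trans with (1 := Cmod_sector_term_le x _ Hx); fold z.
  replace (2 * z ^ S K * (INR (S (K + m)) * z ^ S (K + m)))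
    with (2 * INR (S (K + m)) * (z ^ S K * z ^ S (K + m))) by ring.
  apply Rmult_le_compat_l; [pose proof (pos_INR (S (K + m))); lra|].
  apply Rmult_le_compat_r; [apply pow_le; lra|].
  change (S (K + m)) with (S K + m)%nat; rewrite pow_add.
  rewrite <- (Rmult_1_r (z ^ S K)) at 2.
  apply Rmult_le_compat_l; [apply pow_le; lra|].
  rewrite <- (pow1 m); apply pow_incr; lra.
Qed.

(** Pointwise convergence only: the constant [A] involves [1 / |D|] and depends on [x]. The bound
    with explicit dependence on [x] is left to [sector_tail]. *)
Lemma sector_summand_limit (x eps : R) : 0 < x -> 0 < eps ->
  exists N, forall M, (N <= M)%nat ->
  Cmod (sector_summand p r x - psum (sector_term p r x) M) < eps.
Proof.
intros Hx He.
assert (HD := sector_denominator_neq_0 x Hx).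
set (q := Cexp (- (p * x))) in *.
set (D := (1 - 2 * q * Ccosh (r * x) + q ^ 2)%C) in *.
set (z := exp (- (beta * x / 2))).
set (mu := beta * x / 2).
assert (Hmu : 0 < mu) by (unfold mu; nra).
assert (Hz : 0 < z < 1).
{ split; [apply exp_pos|rewrite <- exp_0; apply exp_increasing; fold mu; lra]. }
assert (Dp : 0 < Cmod D) by (apply Cmod_gt_0, HD).
assert (Hq : Cmod q <= 1).
{ unfold q; rewrite Cmod_Cexp, <- exp_0; apply exp_le_compat.
  assert (A := Rabs_pos (Re r)).
  assert (0 < Re p * x) by (apply Rmult_lt_0_compat; lra).
  unfold Re in *; simpl; lra. }
assert (B : forall k, Cmod (sector_term p r x k) <= 2 / mu ^ 2 * z ^ k).
{ intros k; apply Rle_trans with (1 := Cmod_sector_term_le x k Hx); fold z.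
  assert (Kz : INR k * z ^ k <= / mu ^ 2).
  { destruct k as [|k].
    - simpl INR; rewrite Rmult_0_l; left; apply Rinv_0_lt_compat, pow_lt, Hmu.
    - assert (G := geometric_weight_sum_exp mu k (S k) Hmu).
      rewrite sum_n_n in G; exact G. }
  replace (2 * INR k * (z ^ k * z ^ k)) with (2 * (INR k * z ^ k) * z ^ k) by ring.
  apply Rmult_le_compat_r; [apply pow_le; lra|]; unfold Rdiv; lra. }
(* [psum_geometric] divided by [D] gives the remainder exactly, in terms of rows [M] and [M + 1]. *)
assert (E : forall M, (sector_summand p r x - psum (sector_term p r x) M)%C
  = ((sector_term p r x (S M) - q * q * sector_term p r x M) / D)%C).
{ intros M.
  assert (G := psum_geometric (r * x) q M).
  rewrite (psum_ext _ (sector_term p r x)) in G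
    by (intros k; symmetry; apply sector_term_eq).
  fold D in G; rewrite !sector_term_eq; fold q.
  assert (G' : psum (sector_term p r x) M
    = ((q * (2 * Ccosh (r * x / 2) ^ 2)
       - q ^ S M * trap (fun j => Cexp (IZR j * (r * x))) (S M)
       + q ^ S (S M) * trap (fun j => Cexp (IZR j * (r * x))) M) / D)%C).
  { rewrite <- G; field; exact HD. }
  rewrite G'; unfold sector_summand; fold q; fold D; rewrite !Cpow_S; field; exact HD. }
set (A := 4 / mu ^ 2 / Cmod D).
assert (HA : 0 < A).
{ apply Rdiv_lt_0_compat; [apply Rdiv_lt_0_compat; [lra|apply pow_lt, Hmu]|exact Dp]. }
destruct (pow_lt_1_zero z ltac:(rewrite Rabs_pos_eq; lra) (eps / A)
  ltac:(apply Rdiv_lt_0_compat; lra)) as [N HN].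
exists N; intros M HM; rewrite E.
assert (HN' := HN M HM); rewrite Rabs_pos_eq in HN' by (apply pow_le; lra).
unfold Cdiv; rewrite Cmod_mult, Cmod_inv by exact HD.
apply Rle_lt_trans with (A * z ^ M).
- unfold A, Rdiv.
  replace (4 * / mu ^ 2 * / Cmod D * z ^ M)
    with ((2 * / mu ^ 2 * z ^ M + 1 * (2 * / mu ^ 2 * z ^ M)) * / Cmod D) by ring.
  apply Rmult_le_compat_r; [left; apply Rinv_0_lt_compat, Dp|].
  apply Rle_trans with (1 := Cmod_triangle _ _); rewrite Cmod_opp, Cmod_mult.
  assert (I : 0 < / mu ^ 2) by (apply Rinv_0_lt_compat, pow_lt, Hmu).
  assert (Zp : 0 < z ^ M) by (apply pow_lt; lra).
  apply Rplus_le_compat.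
  + apply Rle_trans with (1 := B (S M)); unfold Rdiv.
    apply Rmult_le_compat_l; [lra|simpl; nra].
  + apply Rmult_le_compat; [apply Cmod_ge_0|apply Cmod_ge_0| |apply B].
    rewrite Cmod_mult; pose proof (Cmod_ge_0 q); nra.
- apply Rmult_lt_reg_l with (/ A); [apply Rinv_0_lt_compat, HA|].
  rewrite <- Rmult_assoc, Rinv_l, Rmult_1_l by lra.
  unfold Rdiv in HN'; lra.
Qed.

(** The bound on [N] further rows does not depend on [N], so it passes to the limit. The factor
    [8 / (beta x)^2] is [2 / mu^2] at [mu = beta x / 2]. *)
Lemma sector_tail (x : R) (K : nat) : 0 < x ->
  Cmod (sector_summand p r x - psum (sector_term p r x) K)
  <= 8 / beta ^ 2 * exp (- 2 * ln x - INR (S K) * (beta / 2) * x).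
Proof.
intros Hx.
set (z := exp (- (beta * x / 2))).
assert (Hz : 0 < z) by apply exp_pos.
assert (Hmu : 0 < beta * x / 2) by nra.
assert (E : 8 / beta ^ 2 * exp (- 2 * ln x - INR (S K) * (beta / 2) * x)
  = 2 * z ^ S K * / (beta * x / 2) ^ 2).
{ unfold z; rewrite <- exp_nat_mult.
  replace (- 2 * ln x - INR (S K) * (beta / 2) * x)
    with (- (ln x + ln x) + INR (S K) * (- (beta * x / 2))) by field.
  rewrite exp_plus, exp_Ropp, exp_plus, exp_ln by exact Hx; field; lra. }
rewrite E; apply le_epsilon; intros eps He.
destruct (sector_summand_limit x eps Hx He) as [N HN].
assert (H1 := HN (K + N)%nat ltac:(lia)).
assert (H2 := Cmod_psum_sector_term_le x K N Hx); fold z in H2.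
assert (H3 := geometric_weight_sum_exp _ K (K + N) Hmu); fold z in H3.
assert (Zp : 0 < z ^ S K) by (apply pow_lt; lra).
apply (Rmult_le_compat_l (2 * z ^ S K)) in H3; [|lra].
replace (sector_summand p r x - psum (sector_term p r x) K)%C
  with ((sector_summand p r x - psum (sector_term p r x) (K + N))
    + (psum (sector_term p r x) (K + N) - psum (sector_term p r x) K))%C by ring.
apply Rle_trans with (1 := Cmod_triangle _ _); lra.
Qed.

End Sector.

Definition Clog (w : C) : C := (ln (Cmod w) + Ci * Arg w)%C.

(* [w ^ (- s)] with the principal argument. *)
Definition Cpow_principal_inv (w s : C) : C := Cexp (- (s * Clog w)).

Lemma Cexp_Clog (w : C) : w <> 0%C -> Cexp (Clog w) = w.
Proof.
intros Hw; unfold Clog; rewrite Cexp_plus.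
transitivity (Cmod w * Cexp (Ci * Arg w))%C; [|apply Cexp_Arg, Hw].
f_equal; unfold Cexp; simpl; rewrite exp_ln, cos_0, sin_0 by (apply Cmod_gt_0, Hw).
apply injective_projections; simpl; ring.
Qed.

Lemma Cmod_pos_Re (w : C) : 0 < Re w -> 0 < Cmod w.
Proof. intros H; pose proof (Re_le_Cmod w); lra. Qed.

Lemma Rabs_Arg_lt (w : C) : 0 < Re w -> Rabs (Arg w) < PI / 2.
Proof.
intros Hw.
assert (Hm := Cmod_pos_Re w Hw).
set (c := Re w / Cmod w).
assert (Hc : 0 < c) by (apply Rdiv_lt_0_compat; assumption).
assert (Hc1 : c <= 1).
{ unfold c; apply Rmult_le_reg_r with (Cmod w); [exact Hm|].
  unfold Rdiv; rewrite Rmult_assoc, Rinv_l by lra; pose proof (Re_le_Cmod w); lra. }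
assert (B := acos_bound c).
assert (H : acos c < PI / 2).
{ destruct (Rlt_dec (acos c) (PI / 2)) as [G|G]; [exact G|].
  assert (C1 := cos_le_0 (acos c) ltac:(lra) ltac:(lra)).
  rewrite cos_acos in C1; lra. }
unfold Arg; fold c; destruct (Rle_dec 0 (Im w)).
- rewrite Rabs_pos_eq; lra.
- rewrite Rabs_Ropp, Rabs_pos_eq; lra.
Qed.

Lemma is_CRInt_0_infty_gamma_kernel_principal (s w : C) : 0 < Re s -> 0 < Re w ->
  is_CRInt_0_infty (gamma_kernel s w) (CGamma s * Cpow_principal_inv w s)%C.
Proof.
intros Hs Hw.
assert (W : w <> 0%C) by (apply Cmod_gt_0, Cmod_pos_Re, Hw).
rewrite <- (Cexp_Clog w W) at 1.
apply is_CRInt_0_infty_gamma_kernel; [exact Hs|].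
replace (Im (Clog w)) with (Arg w) by (unfold Clog, Im; simpl; ring).
apply Rabs_Arg_lt, Hw.
Qed.

Definition sector_sum (p r s : C) (K : nat) : C :=
  psum (fun k => trap (fun j => Cpow_principal_inv (INR k * p + IZR j * r) s) k) K.

Definition sector_integrand (p r s : C) (x : R) : C :=
  (Cexp ((s - 1) * ln x) * sector_summand p r x)%C.

(** Instead of dominated convergence, the tail times [x^(Re s - 1)] is bounded by a multiple of a
    real Gamma kernel with exponent [Re s - 2], whose integral is known and tends to [0]. *)
Lemma sector_integral (p r s : C) (beta : R) :
  0 < beta -> Rabs (Re r) + beta <= Re p -> 2 < Re s ->
  exists l, is_CRInt_0_infty (sector_integrand p r s) l /\
    forall eps, 0 < eps -> exists N, forall K, (N <= K)%nat ->
      Cmod (CGamma s * sector_sum p r s K - l) < eps.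
Proof.
intros Hb Hpr Hs.
set (G := fun K x => (Cexp ((s - 1) * ln x) * psum (sector_term p r x) K)%C).
assert (HG : forall K, is_CRInt_0_infty (G K) (CGamma s * sector_sum p r s K)%C).
{ intros K; unfold sector_sum; rewrite <- psum_Cmult.
  apply is_CRInt_0_infty_ext with
    (f := fun x => psum (fun k => Cexp ((s - 1) * ln x) * sector_term p r x k)%C K).
  { intros x _; apply psum_Cmult. }
  apply is_CRInt_0_infty_psum; intros [|k].
  (* Row [0] is treated apart: its only point would be [0], outside the open right half plane. *)
  { simpl; rewrite Cmult_0_r; apply is_CRInt_0_infty_ext with (2 := is_CRInt_0_infty_zero).
    intros x _; unfold sector_term, trap; ring. }
  rewrite <- trap_Cmult.
  apply is_CRInt_0_infty_ext with
    (f := fun x => trap (fun j => gamma_kernel s (INR (S k) * p + IZR j * r) x) (S k)).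
  { intros x _; unfold sector_term; rewrite <- trap_Cmult.
    apply trap_ext; intros j _; unfold gamma_kernel; rewrite <- Cexp_plus; f_equal; ring. }
  apply is_CRInt_0_infty_trap; intros j Hj.
  apply is_CRInt_0_infty_gamma_kernel_principal; [lra|].
  apply Rlt_le_trans with (2 := Re_sector_point p r beta Hpr (S k) j Hj).
  apply Rmult_lt_0_compat; [apply lt_0_INR; lia|exact Hb]. }
assert (Tail : forall K x, 0 < x ->
  Cmod (sector_integrand p r s x - G K x)
  <= 8 / beta ^ 2 * exp ((Re s - 2 - 1) * ln x - INR (S K) * (beta / 2) * x)).
{ intros K x Hx; unfold sector_integrand, G.
  replace (_ - _)%C with (Cexp ((s - 1) * ln x)
    * (sector_summand p r x - psum (sector_term p r x) K))%C by ring.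
  rewrite Cmod_mult, Cmod_Cexp.
  replace (exp ((Re s - 2 - 1) * ln x - INR (S K) * (beta / 2) * x))
    with (exp (Re ((s - 1) * ln x)%C) * exp (- 2 * ln x - INR (S K) * (beta / 2) * x)).
  2: { rewrite <- exp_plus; f_equal; unfold Re; simpl; ring. }
  rewrite (Rmult_comm (8 / _)), Rmult_assoc, (Rmult_comm _ (8 / _)).
  apply Rmult_le_compat_l; [left; apply exp_pos|].
  apply sector_tail; assumption. }
destruct (ex_is_CRInt_0_infty_power_exp (sector_integrand p r s) (Re s - 2) (beta / 2)
  (8 / beta ^ 2)) as [l Hl]; [lra|lra| | |].
{ intros x Hx; unfold sector_integrand, sector_summand, Ccosh, Cdiv, Cminus.
  assert (HD := sector_denominator_neq_0 p r beta Hb Hpr x Hx).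
  assert (CD : continuous (fun x : R => / (1 - 2 * Cexp (- (p * x)) * Ccosh (r * x)
     + Cexp (- (p * x)) ^ 2))%C x).
  { apply continuous_Cinv; [|exact HD].
    unfold Ccosh, Cdiv, Cminus; simpl; solve_Ccont. }
  unfold Ccosh, Cdiv, Cminus in CD.
  apply continuous_Cmult; [solve_Ccont|].
  apply continuous_Cmult; [solve_Ccont|].
  apply continuous_Cmult; [|exact CD].
  simpl; solve_Ccont. }
(* With no rows the partial sum is [0], so the tail bound for [K = 0] bounds the whole integrand. *)
{ intros x Hx; assert (T := Tail 0%nat x Hx); unfold G in T; cbn [psum] in T.
  rewrite Cmult_0_r in T; unfold Cminus in T; rewrite Copp_0, Cplus_0_r in T.
  simpl INR in T; rewrite Rmult_1_l in T; exact T. }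
exists l; split; [exact Hl|].
set (a := Re s - 2).
assert (Ha : 0 < a) by (unfold a; lra).
(* The error integral is [8 / beta^2 * Gamma(a) * ((K + 1) beta / 2) ^ (- a)]. *)
assert (Err : forall K, Cmod (l - CGamma s * sector_sum p r s K)
  <= 8 / beta ^ 2 * (Re (CGamma a) * exp (- (a * ln (INR (S K) * (beta / 2)))))).
{ intros K.
  set (kap := INR (S K) * (beta / 2)).
  assert (Hkap : 0 < kap) by (apply Rmult_lt_0_compat; [apply lt_0_INR; lia|lra]).
  (* For a real logarithm the rotation degenerates to the scaling of [x] by [kap]. *)
  assert (I := is_CRInt_0_infty_gamma_kernel (RtoC a) (RtoC (ln kap)) Ha).
  assert (I' := is_CRInt_0_infty_Cmult (RtoC (8 / beta ^ 2)) _ _ (I ltac:(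
    simpl; rewrite Rabs_R0; pose proof PI_RGT_0; lra))).
  assert (X : forall t : R, Cexp t = RtoC (exp t)).
  { intros t; unfold Cexp; simpl; rewrite cos_0, sin_0.
    apply injective_projections; simpl; ring. }
  rewrite X, exp_ln, <- RtoC_mult, <- RtoC_opp, X in I' by exact Hkap.
  assert (B : forall x, 0 < x -> Cmod (sector_integrand p r s x - G K x)
    <= Re ((8 / beta ^ 2)%R * gamma_kernel a kap x)%C).
  { intros x Hx; rewrite gamma_kernel_RtoC, <- RtoC_mult; exact (Tail K x Hx). }
  assert (M := Cmod_is_CRInt_0_infty_le _ _ _ _ B
    (is_CRInt_0_infty_minus _ _ _ _ Hl (HG K)) I').
  rewrite Re_RtoC_mult, (Cmult_comm (CGamma (RtoC a))), Re_RtoC_mult, (Rmult_comm (exp _)) in M.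
  exact M. }
intros eps He.
(* The absolute value and the [1] make [Q] positive without information on [Gamma(a)] for small [a].
   Next, [t] solves [Q e^(-a t) = eps], and [N] makes [kap] exceed [e^t]. *)
set (Q := 8 / beta ^ 2 * (Rabs (Re (CGamma a)) + 1)).
assert (Hc : 0 < 8 / beta ^ 2) by (apply Rdiv_lt_0_compat; [lra|apply pow_lt, Hb]).
assert (HR := Rabs_pos (Re (CGamma a))).
assert (HQ : 0 < Q) by (apply Rmult_lt_0_compat; lra).
set (t := - ln (eps / Q) / a).
destruct (nfloor_ex (exp t / (beta / 2))) as [N HN].
{ left; apply Rdiv_lt_0_compat; [apply exp_pos|lra]. }
exists N; intros K HK; rewrite Cmod_minus_sym.
apply Rle_lt_trans with (1 := Err K).
set (kap := INR (S K) * (beta / 2)).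
assert (Hkap : exp t < kap).
{ apply Rmult_lt_reg_r with (/ (beta / 2)); [apply Rinv_0_lt_compat; lra|].
  replace (kap * / (beta / 2)) with (INR (S K)) by (unfold kap; field; lra).
  apply Rlt_le_trans with (INR N + 1); [apply HN|].
  rewrite <- S_INR; apply le_INR; lia. }
assert (HL : t < ln kap).
{ rewrite <- (ln_exp t); apply ln_increasing; [apply exp_pos|exact Hkap]. }
assert (HE : exp (- (a * ln kap)) < eps / Q).
{ rewrite <- (exp_ln (eps / Q)) by (apply Rdiv_lt_0_compat; lra).
  apply exp_increasing; apply (Rmult_lt_compat_l a) in HL; [|exact Ha].
  replace (a * t) with (- ln (eps / Q)) in HL by (unfold t; field; lra); lra. }
apply Rle_lt_trans with (Q * exp (- (a * ln kap))).
- unfold Q; rewrite Rmult_assoc; apply Rmult_le_compat_l; [lra|].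
  apply Rmult_le_compat_r; [left; apply exp_pos|].
  pose proof (Rle_abs (Re (CGamma a))); lra.
- apply Rlt_le_trans with (Q * (eps / Q)).
  + apply Rmult_lt_compat_l; assumption.
  + apply Req_le; field; lra.
Qed.

(** * The lattice sum *)

Lemma Cexp_Ci (a : R) : Cexp (Ci * a) = (cos a, sin a).
Proof.
unfold Cexp; simpl.
replace (0 * a - 1 * 0) with 0 by ring; replace (0 * 0 + 1 * a) with a by ring.
rewrite exp_0; apply injective_projections; simpl; ring.
Qed.

Lemma Cexp_Ci_inj (a b : R) :
  Cexp (Ci * a) = Cexp (Ci * b) -> Rabs (a - b) < 2 * PI -> a = b.
Proof.
rewrite !Cexp_Ci; intros E H; injection E; intros Es Ec.
apply Rabs_def2 in H.
assert (C1 : cos (a - b) = 1).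
{ rewrite cos_minus, Ec, Es; pose proof (sin2_cos2 b) as Q; unfold Rsqr in Q; lra. }
assert (C2 : cos (a - b) = 1 - 2 * sin ((a - b) / 2) * sin ((a - b) / 2)).
{ rewrite <- cos_2a_sin; f_equal; field. }
assert (S0 : sin ((a - b) / 2) = 0) by nra.
destruct (Rtotal_order a b) as [L|[L|L]]; [|exact L|].
- assert (0 < sin (- ((a - b) / 2))) by (apply sin_gt_0; lra).
  rewrite sin_neg in *; lra.
- assert (0 < sin ((a - b) / 2)) by (apply sin_gt_0; lra); lra.
Qed.

Lemma Arg_bound (w : C) : - PI <= Arg w <= PI.
Proof.
unfold Arg; assert (B := acos_bound (Re w / Cmod w)).
destruct (Rle_dec 0 (Im w)); lra.
Qed.

Lemma Cmod_polar (rho a : R) : 0 <= rho -> Cmod (rho * Cexp (Ci * a)) = rho.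
Proof.
intros H; rewrite Cmod_mult, Cmod_Cexp, Cmod_RtoC_pos by exact H.
replace (Re (Ci * a)) with 0 by (unfold Re; simpl; ring); rewrite exp_0; ring.
Qed.

Lemma Cexp_Arg_polar (rho a : R) : 0 < rho ->
  Cexp (Ci * Arg (rho * Cexp (Ci * a))) = Cexp (Ci * a).
Proof.
intros H; set (w := (rho * Cexp (Ci * a))%C).
assert (Hm : Cmod w = rho) by (apply Cmod_polar; lra).
assert (W : w <> 0%C) by (apply Cmod_gt_0; lra).
assert (E := Cexp_Arg w W); rewrite Hm in E; unfold w at 2 in E.
assert (R0 : RtoC rho <> 0%C) by (intros Q; apply RtoC_inj in Q; lra).
transitivity (/ rho * (rho * Cexp (Ci * Arg w)))%C; [field; exact R0|].
rewrite E; field; exact R0.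
Qed.

Lemma Arg_polar (rho a : R) : 0 < rho -> - PI < a < PI ->
  Arg (rho * Cexp (Ci * a)) = a.
Proof.
intros H Ha; apply Cexp_Ci_inj; [apply Cexp_Arg_polar, H|].
assert (B := Arg_bound (rho * Cexp (Ci * a))); apply Rabs_def1; lra.
Qed.

Lemma arg_from_polar (theta rho a : R) : 0 < rho -> - PI < theta <= PI ->
  theta <= a < theta + 2 * PI -> arg_from theta (rho * Cexp (Ci * a)) = a.
Proof.
intros H Ht Ha; apply Cexp_Ci_inj.
{ rewrite Cexp_arg_from; apply Cexp_Arg_polar, H. }
assert (B := Arg_bound (rho * Cexp (Ci * a))).
unfold arg_from; destruct (Rlt_dec _ theta); apply Rabs_def1; lra.
Qed.

(** As long as [Arg w + d] stays in the window of the branch, rotating by [d] costs the constant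
    factor [e^(-ids)]. The cut matters only through this window condition. *)
Lemma Cpow_from_inv (theta d : R) (w s : C) :
  - PI < theta <= PI -> w <> 0%C -> theta <= Arg w + d < theta + 2 * PI ->
  (1 / Cpow_from theta (w * Cexp (Ci * d)) s
   = Cexp (- (Ci * d * s)) * Cpow_principal_inv w s)%C.
Proof.
intros Ht Hw Ha.
assert (Hm : 0 < Cmod w) by (apply Cmod_gt_0, Hw).
assert (E : (w * Cexp (Ci * d))%C = (Cmod w * Cexp (Ci * (Arg w + d)%R))%C).
{ rewrite <- (Cexp_Arg w Hw) at 1.
  rewrite RtoC_plus, Cmult_plus_distr_l, Cexp_plus; ring. }
rewrite E; unfold Cpow_from, Cpow_principal_inv, Clog, Rcpow.
rewrite arg_from_polar, Cmod_polar by lra.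
unfold Cdiv; rewrite Cmult_1_l, <- !Cexp_plus, <- Cexp_opp; f_equal.
rewrite RtoC_plus; ring.
Qed.

(** Cross and dot product in polar form: they turn the sign of a real expression in the coordinates
    into the relative position of two arguments. *)
Lemma Arg_cross (z w : C) : z <> 0%C -> w <> 0%C ->
  Im z * Re w - Re z * Im w = Cmod z * Cmod w * sin (Arg z - Arg w) /\
  Re z * Re w + Im z * Im w = Cmod z * Cmod w * cos (Arg z - Arg w).
Proof.
intros Hz Hw.
assert (Ez := Cexp_Arg z Hz); assert (Ew := Cexp_Arg w Hw).
rewrite Cexp_Ci in Ez, Ew.
rewrite <- Ez at 1 2 5 6; rewrite <- Ew at 1 2 5 6.
unfold Re, Im; simpl; rewrite sin_minus, cos_minus; split; ring.
Qed.

Lemma sum_n_head (h : nat -> C) (n : nat) :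
  sum_n h (S n) = (h O + sum_n (fun i => h (S i)) n)%C.
Proof.
induction n as [|n IH].
- rewrite sum_Sn, !sum_O; reflexivity.
- rewrite sum_Sn, IH, sum_Sn; unfold plus; simpl; ring.
Qed.

Lemma sum_n_csum (g : Z -> C) (K : nat) :
  sum_n (fun i => g (Z.of_nat i - Z.of_nat K)%Z) (2 * K) = csum g K.
Proof.
induction K as [|K IH].
- simpl; rewrite sum_O; reflexivity.
- replace (2 * S K)%nat with (S (S (2 * K))) by lia.
  rewrite sum_n_head, sum_Sn; cbn [csum].
  rewrite (sum_n_ext _ (fun i => g (Z.of_nat i - Z.of_nat K)%Z)), IH.
  2: { intros i; f_equal; lia. }
  unfold plus; simpl plus.
  replace (Z.of_nat 0 - Z.of_nat (S K))%Z with (- Z.of_nat (S K))%Z by lia.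
  replace (Z.of_nat (S (S (2 * K))) - Z.of_nat (S K))%Z with (Z.of_nat (S K)) by lia.
  change (g (- Z.of_nat (S K))%Z + (csum g K + g (Z.of_nat (S K)))
    = csum g K + (g (Z.of_nat (S K)) + g (- Z.of_nat (S K))%Z))%C; ring.
Qed.

Lemma square_sum_csum (f : Z -> Z -> C) (K : nat) :
  square_sum f K = csum (fun m => csum (f m) K) K.
Proof.
unfold square_sum; rewrite <- sum_n_csum; apply sum_n_ext; intros i.
apply (sum_n_csum (f (Z.of_nat i - Z.of_nat K)%Z)).
Qed.

(** The corners are kept apart from the open sides because each of them belongs to two sectors. *)
Lemma square_sum_S (f : Z -> Z -> C) (K : nat) :
  let k := Z.of_nat (S K) in
  square_sum f (S K) = (square_sum f K
    + (csum (f k) K + csum (f (- k)%Z) K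
       + csum (fun j => f j k) K + csum (fun j => f j (- k)%Z) K)
    + (f k k + f k (- k)%Z + f (- k)%Z k + f (- k)%Z (- k)%Z))%C.
Proof.
intros k; rewrite !square_sum_csum; cbn [csum]; fold k.
rewrite !csum_plus; ring.
Qed.

Section Lattice.
Variables tau s : C.
Hypothesis (Hre : - (1 / 2) < Re tau <= 1 / 2) (Him : 0 < Im tau).

Let A : R := Arg (1 + tau)%C.
(** The phases of the left, upper and lower sectors, obtained by rotating the right half plane by
    [PI], [PI / 2] and [- PI / 2]; the right sector has phase [1]. *)
Let e1 : C := Cexp (- (Ci * PI * s)).
Let e2 : C := Cexp (- (Ci * (PI / 2)%R * s)).
Let e3 : C := Cexp (- (Ci * (- (PI / 2))%R * s)).

Lemma one_plus_tau_neq_0 : (1 + tau)%C <> 0%C.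
Proof. intros H; apply (f_equal Re) in H; unfold Re in *; simpl in H; lra. Qed.

Lemma Arg_one_plus_tau : 0 < A < PI / 2.
Proof.
assert (B : Rabs A < PI / 2) by (apply Rabs_Arg_lt; unfold Re in *; simpl; lra).
apply Rabs_def2 in B; split; [|lra].
assert (E := Cexp_Arg _ one_plus_tau_neq_0); fold A in E; rewrite Cexp_Ci in E.
assert (Hm : 0 < Cmod (1 + tau)) by (apply Cmod_gt_0, one_plus_tau_neq_0).
apply (f_equal snd) in E; simpl in E; unfold Im in Him.
destruct (Rlt_dec 0 A) as [G|G]; [exact G|].
assert (S : sin A <= 0).
{ rewrite <- (Ropp_involutive A), sin_neg.
  assert (0 <= sin (- A)) by (apply sin_ge_0; lra); lra. }
nra.
Qed.

Lemma theta_cut_eq : theta_cut tau = A - PI.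
Proof.
unfold theta_cut.
assert (B := Arg_one_plus_tau); assert (PP := PI_RGT_0).
assert (Hm : 0 < Cmod (1 + tau)) by (apply Cmod_gt_0, one_plus_tau_neq_0).
assert (E : (- (1) - tau)%C = (Cmod (1 + tau) * Cexp (Ci * (A - PI)%R))%C).
{ rewrite Cexp_Ci, cos_minus, sin_minus, cos_PI, sin_PI.
  transitivity (- (Cmod (1 + tau) * Cexp (Ci * A)))%C.
  - unfold A; rewrite Cexp_Arg by apply one_plus_tau_neq_0; ring.
  - rewrite Cexp_Ci; apply injective_projections; simpl; ring. }
rewrite E; apply Arg_polar; lra.
Qed.

Variable K : nat.
Let k : Z := Z.of_nat (S K).
(** Row [S K] of the right sector, and of the upper sector turned by [- PI / 2] into the right half
    plane. *)
Let PR (j : Z) : C := Cpow_principal_inv (INR (S K) * 1 + IZR j * tau) s.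
Let PU (j : Z) : C := Cpow_principal_inv (INR (S K) * - (Ci * tau) + IZR j * Ci) s.

Lemma IZR_k : IZR k = INR (S K).
Proof. symmetry; apply INR_IZR_INZ. Qed.

Lemma k_pos : 1 <= INR (S K).
Proof. rewrite S_INR; pose proof (pos_INR K); lra. Qed.

Lemma Rabs_IZR_le (j : Z) : (Z.abs j <= k)%Z -> - INR (S K) <= IZR j <= INR (S K).
Proof.
intros H; rewrite <- IZR_k, <- opp_IZR; split; apply IZR_le; lia.
Qed.

Lemma Re_right_pos (j : Z) : (Z.abs j <= k)%Z -> 0 < Re (INR (S K) * 1 + IZR j * tau).
Proof.
intros H; apply Rabs_IZR_le in H; assert (Kp := k_pos).
unfold Re in *; cbn [fst snd Cplus Cmult RtoC]; nra.
Qed.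

Lemma Re_up_pos (j : Z) : 0 < Re (INR (S K) * - (Ci * tau) + IZR j * Ci).
Proof.
assert (Kp := k_pos).
replace (Re (INR (S K) * - (Ci * tau) + IZR j * Ci)) with (INR (S K) * Im tau).
- apply Rmult_lt_0_compat; lra.
- unfold Re, Im; cbn [fst snd Cplus Cmult Copp RtoC Ci]; ring.
Qed.

Lemma Re_pos_neq_0 (w : C) : 0 < Re w -> w <> 0%C.
Proof. intros H E; rewrite E in H; simpl in H; lra. Qed.

Lemma lattice_term_off_cut (m n : Z) (w : C) (d : R) :
  ~ (m = 0 /\ n = 0)%Z -> ~ (m = n /\ m < 0)%Z ->
  (IZR m + IZR n * tau)%C = (w * Cexp (Ci * d))%C -> 0 < Re w ->
  A - PI <= Arg w + d < A + PI ->
  lattice_term tau s m n = (Cexp (- (Ci * d * s)) * Cpow_principal_inv w s)%C.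
Proof.
intros H0 H1 E Hw Ha; unfold lattice_term.
replace (Z.eqb m 0 && Z.eqb n 0)%bool with false.
2: { symmetry; apply Bool.not_true_iff_false; intros B.
     apply Bool.andb_true_iff in B; rewrite !Z.eqb_eq in B; tauto. }
replace (Z.eqb m n && Z.ltb m 0)%bool with false.
2: { symmetry; apply Bool.not_true_iff_false; intros B.
     apply Bool.andb_true_iff in B; rewrite Z.eqb_eq, Z.ltb_lt in B; tauto. }
assert (B := Arg_one_plus_tau); assert (PP := PI_RGT_0).
rewrite E, theta_cut_eq; apply Cpow_from_inv; [lra|apply Re_pos_neq_0, Hw|lra].
Qed.

Lemma lattice_term_right (j : Z) : (Z.abs j <= k)%Z -> lattice_term tau s k j = PR j.
Proof.
intros Hj; assert (Hw := Re_right_pos j Hj).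
assert (B := Arg_one_plus_tau); assert (R1 := Rabs_def2 _ _ (Rabs_Arg_lt _ Hw)).
rewrite (lattice_term_off_cut k j (INR (S K) * 1 + IZR j * tau) 0); auto; try lia; try lra.
- rewrite Cmult_0_r, Cmult_0_l, Copp_0, Cexp_0; apply Cmult_1_l.
- rewrite Cmult_0_r, Cexp_0, IZR_k; ring.
Qed.

Lemma lattice_term_up (j : Z) : (Z.abs j <= k)%Z ->
  lattice_term tau s j k = (e2 * PU (- j)%Z)%C.
Proof.
intros Hj; assert (Hw := Re_up_pos (- j)).
assert (B := Arg_one_plus_tau); assert (R1 := Rabs_def2 _ _ (Rabs_Arg_lt _ Hw)).
apply lattice_term_off_cut; auto; try lia; try lra.
rewrite Cexp_Ci, cos_PI2, sin_PI2, IZR_k, opp_IZR.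
apply injective_projections; cbn [fst snd Cplus Cmult Copp RtoC Ci]; ring.
Qed.

(** The window condition is [Arg w < A]. The cross product of [1 + tau] and [w] is
    [Im tau * (k + j)], positive for [j > - k]; at [j = - k] the point reaches the cut. *)
Lemma lattice_term_left (j : Z) : (- k < j <= k)%Z ->
  lattice_term tau s (- k) j = (e1 * PR (- j)%Z)%C.
Proof.
intros Hj; assert (Hw := Re_right_pos (- j) ltac:(lia)).
assert (B := Arg_one_plus_tau); assert (R1 := Rabs_def2 _ _ (Rabs_Arg_lt _ Hw)).
apply lattice_term_off_cut; auto; try lia.
- rewrite Cexp_Ci, cos_PI, sin_PI, <- IZR_k, !opp_IZR.
  apply injective_projections; cbn [fst snd Cplus Cmult Copp RtoC Ci]; ring.
- split; [lra|].
  set (w := (INR (S K) * 1 + IZR (- j) * tau)%C) in *.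
  assert (Cr := proj1 (Arg_cross _ w one_plus_tau_neq_0 (Re_pos_neq_0 _ Hw))).
  replace (Im (1 + tau) * Re w - Re (1 + tau) * Im w) with (Im tau * (IZR k + IZR j)) in Cr.
  2: { unfold w; rewrite opp_IZR, IZR_k; unfold Re, Im;
       cbn [fst snd Cplus Cmult Copp RtoC Ci]; ring. }
  assert (P : 0 < IZR k + IZR j) by (rewrite <- plus_IZR; apply IZR_lt; lia).
  assert (P' := Rmult_lt_0_compat _ _ Him P); rewrite Cr in P'; fold A in P'.
  assert (M : 0 < Cmod (1 + tau) * Cmod w).
  { apply Rmult_lt_0_compat; apply Cmod_gt_0; [apply one_plus_tau_neq_0|apply Re_pos_neq_0, Hw]. }
  destruct (Rlt_dec (Arg w) A) as [G|G]; [lra|].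
  assert (S : 0 <= sin (- (A - Arg w))) by (apply sin_ge_0; lra).
  rewrite sin_neg in S; nra.
Qed.

(** Here the window asks for [A - Arg w <= PI / 2], and the dot product of [1 + tau] and [w] is
    again [Im tau * (k + j)]. *)
Lemma lattice_term_down (j : Z) : (- k < j <= k)%Z ->
  lattice_term tau s j (- k) = (e3 * PU j)%C.
Proof.
intros Hj; assert (Hw := Re_up_pos j).
assert (B := Arg_one_plus_tau); assert (R1 := Rabs_def2 _ _ (Rabs_Arg_lt _ Hw)).
apply lattice_term_off_cut; auto; try lia.
- rewrite Cexp_Ci, cos_neg, sin_neg, cos_PI2, sin_PI2, <- IZR_k, !opp_IZR.
  apply injective_projections; cbn [fst snd Cplus Cmult Copp RtoC Ci]; ring.
- split; [|lra].
  set (w := (INR (S K) * - (Ci * tau) + IZR j * Ci)%C) in *.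
  assert (Cr := proj2 (Arg_cross _ w one_plus_tau_neq_0 (Re_pos_neq_0 _ Hw))).
  replace (Re (1 + tau) * Re w + Im (1 + tau) * Im w) with (Im tau * (IZR k + IZR j)) in Cr.
  2: { unfold w; rewrite IZR_k; unfold Re, Im;
       cbn [fst snd Cplus Cmult Copp RtoC Ci]; ring. }
  assert (P : 0 < IZR k + IZR j) by (rewrite <- plus_IZR; apply IZR_lt; lia).
  assert (P' := Rmult_lt_0_compat _ _ Him P); rewrite Cr in P'; fold A in P'.
  assert (M : 0 < Cmod (1 + tau) * Cmod w).
  { apply Rmult_lt_0_compat; apply Cmod_gt_0; [apply one_plus_tau_neq_0|apply Re_pos_neq_0, Hw]. }
  destruct (Rle_dec (A - PI) (Arg w + - (PI / 2))) as [G|G]; [exact G|].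
  assert (S : cos (A - Arg w) <= 0) by (apply cos_le_0; lra).
  nra.
Qed.

(** Continued to the cut, the left sector sees the argument [A + PI = theta + 2 PI] and the lower
    sector sees [A - PI = theta]. *)
Lemma lattice_term_cut : lattice_term tau s (- k) (- k) = ((e1 * PR k + e3 * PU (- k)%Z) / 2)%C.
Proof.
assert (B := Arg_one_plus_tau); assert (PP := PI_RGT_0); assert (Kp := k_pos).
assert (Hm : 0 < Cmod (1 + tau)) by (apply Cmod_gt_0, one_plus_tau_neq_0).
set (rho := INR (S K) * Cmod (1 + tau)).
assert (Hr : 0 < rho) by (apply Rmult_lt_0_compat; lra).
assert (E1 : (INR (S K) * 1 + IZR k * tau)%C = (rho * Cexp (Ci * A))%C).
{ unfold rho, A; rewrite RtoC_mult, <- Cmult_assoc, Cexp_Arg, IZR_k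
    by apply one_plus_tau_neq_0; ring. }
assert (E2 : (INR (S K) * - (Ci * tau) + IZR (- k) * Ci)%C
  = (rho * Cexp (Ci * (A - PI / 2)%R))%C).
{ transitivity (- Ci * (rho * Cexp (Ci * A)))%C.
  - rewrite <- E1, opp_IZR, IZR_k, RtoC_opp; ring.
  - rewrite !Cexp_Ci, cos_minus, sin_minus, cos_PI2, sin_PI2.
    apply injective_projections; cbn [fst snd Cplus Cmult Copp RtoC Ci]; ring. }
unfold lattice_term, PR, PU, Cpow_principal_inv, Clog, e1, e3.
rewrite E1, E2, !Cmod_polar, !Arg_polar by lra.
replace (Z.eqb (- k) 0 && Z.eqb (- k) 0)%bool with false.
2: { symmetry; apply Bool.not_true_iff_false; intros G.
     apply Bool.andb_true_iff in G; rewrite !Z.eqb_eq in G; unfold k in G; lia. }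
replace (Z.eqb (- k) (- k) && Z.ltb (- k) 0)%bool with true.
2: { symmetry; apply Bool.andb_true_iff; rewrite Z.eqb_eq, Z.ltb_lt; unfold k; lia. }
rewrite Z.opp_involutive, IZR_k, theta_cut_eq; fold rho.
unfold Rcpow; set (X := Cexp (s * ln rho)).
assert (HX : X <> 0%C) by apply Cexp_neq_0.
transitivity ((/ X * Cexp (- (Ci * (A - PI)%R * s))
  + / X * Cexp (- (Ci * ((A - PI)%R + 2 * PI) * s))) / 2)%C.
{ field; repeat split; first [exact HX|apply C2_neq_0]. }
unfold X; rewrite <- !Cexp_opp, <- !Cexp_plus, Cplus_comm; unfold Cdiv; do 2 f_equal;
  f_equal; rewrite !RtoC_minus, ?RtoC_opp; rewrite ?RtoC_div, ?RtoC_mult; try lra;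
  field; apply C2_neq_0.
Qed.

Lemma square_sum_lattice_S :
  square_sum (lattice_term tau s) (S K) = (square_sum (lattice_term tau s) K
    + (1 + e1) * trap PR (S K) + (e2 + e3) * trap PU (S K))%C.
Proof.
rewrite square_sum_S; fold k; unfold trap; fold k.
rewrite (csum_ext (lattice_term tau s k) PR) by (intros; apply lattice_term_right; lia).
rewrite (csum_ext (lattice_term tau s (- k)) (fun j => e1 * PR (- j)%Z)%C)
  by (intros; apply lattice_term_left; lia).
rewrite (csum_ext (fun j => lattice_term tau s j k) (fun j => e2 * PU (- j)%Z)%C)
  by (intros; apply lattice_term_up; lia).
rewrite (csum_ext (fun j => lattice_term tau s j (- k)) (fun j => e3 * PU j)%C)
  by (intros; apply lattice_term_down; lia).
rewrite !csum_Cmult, (csum_opp_index PR), (csum_opp_index PU), lattice_term_cut.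
assert (R1 := lattice_term_right k ltac:(lia)).
assert (U1 := lattice_term_up k ltac:(lia)).
assert (R2 := lattice_term_right (- k) ltac:(lia)).
assert (D2 := lattice_term_down k ltac:(lia)).
assert (L3 := lattice_term_left k ltac:(lia)).
assert (U3 := lattice_term_up (- k) ltac:(lia)).
rewrite Z.opp_involutive in U3.
(* Each corner off the cut lies on the boundary of two sectors; take half of each value. *)
assert (Half : forall x y z : C, x = y -> x = z -> x = ((y + z) / 2)%C).
{ intros x y z <- <-; field; apply C2_neq_0. }
rewrite (Half _ _ _ R1 U1), (Half _ _ _ R2 D2), (Half _ _ _ L3 U3).
field; apply C2_neq_0.
Qed.

End Lattice.

Lemma square_sum_lattice (tau s : C) (K : nat) :
  - (1 / 2) < Re tau <= 1 / 2 -> 0 < Im tau ->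
  square_sum (lattice_term tau s) K
  = ((1 + Cexp (- (Ci * PI * s))) * sector_sum 1 tau s K
     + (Cexp (- (Ci * (PI / 2)%R * s)) + Cexp (- (Ci * (- (PI / 2))%R * s)))
       * sector_sum (- (Ci * tau)) Ci s K)%C.
Proof.
intros Hre Him; induction K as [|K IH].
- rewrite square_sum_csum; unfold sector_sum; cbn [csum psum].
  change (lattice_term tau s 0 0) with (RtoC 0); ring.
- rewrite square_sum_lattice_S, IH by assumption.
  unfold sector_sum; cbn [psum]; ring.
Qed.

(** * Assembling the formula *)

Lemma integrand_sectors (tau s : C) (x : R) :
  integrand tau s x = (Cexp (- (Ci * (PI / 2)%R * s)) / 2 * sector_integrand 1 tau s x
    + / 2 * sector_integrand (- (Ci * tau)) Ci s x)%C.
Proof.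
unfold integrand, sector_integrand, sector_summand, f1, f2, Rcpow.
assert (E1 : Cexp (- (Ci * s * PI / 2)) = Cexp (- (Ci * (PI / 2)%R * s))).
{ f_equal; rewrite RtoC_div by lra; field; apply C2_neq_0. }
assert (E2 : Cexp (- (1 * x)) = Cexp (- RtoC x)) by (f_equal; ring).
assert (E3 : (Cexp (- RtoC x) ^ 2)%C = Cexp (- (2 * x))).
{ simpl; rewrite Cmult_1_r, <- Cexp_plus; f_equal; ring. }
assert (E4 : Cexp (- (- (Ci * tau) * x)) = Cexp (Ci * tau * x)) by (f_equal; ring).
assert (E5 : (Cexp (Ci * tau * x) ^ 2)%C = Cexp (2 * Ci * tau * x)).
{ simpl; rewrite Cmult_1_r, <- Cexp_plus; f_equal; ring. }
assert (E6 : Ccosh (Ci * x / 2) = Ccos (x / 2)).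
{ unfold Ccosh, Ccos; do 3 f_equal; field; apply C2_neq_0. }
rewrite E1, E2, E3, E4, E5, E6.
change (Ccosh (Ci * x)) with (Ccos x).
unfold Cdiv.
set (Y1 := (/ (1 - 2 * Cexp (- RtoC x) * Ccosh (tau * x) + Cexp (- (2 * x))))%C).
set (Y2 := (/ (1 - 2 * Cexp (Ci * tau * x) * Ccos x + Cexp (2 * Ci * tau * x)))%C).
field; apply C2_neq_0.
Qed.

Lemma filterlim_C_eps (u : nat -> C) (l : C) :
  (forall eps, 0 < eps -> exists N, forall K, (N <= K)%nat -> Cmod (u K - l) < eps) ->
  filterlim u eventually (locally (T := C_R_CompleteNormedModule) l).
Proof.
intros H P HP.
apply (locally_norm_le_locally (V := C_R_NormedModule)) in HP.
destruct HP as [eps HP].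
destruct (H eps (cond_pos eps)) as [N HN]; exists N; intros K HK; apply HP.
unfold ball_norm; rewrite norm_C_R; apply HN, HK.
Qed.

(** Completeness specifies [lim] on Cauchy proper filters; two limits of one filter are [close], and
    close points of a normed module coincide. *)
Lemma lim_unique_C (u : nat -> C) (l : C) :
  filterlim u eventually (locally (T := C_R_CompleteNormedModule) l) ->
  lim (T := C_R_CompleteNormedModule) (filtermap u eventually) = l.
Proof.
intros H.
assert (PF : ProperFilter (filtermap u eventually))
  by (apply filtermap_proper_filter, eventually_filter).
apply (eq_close (V := C_R_NormedModule)).
apply (is_filter_lim_close (T := C_R_CompleteNormedModule) (F := filtermap u eventually)).
- intros P [eps HP].
  apply (filter_imp _ _ HP).
  apply (complete_cauchy (T := C_R_CompleteNormedModule) (filtermap u eventually) PF).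
  intros e; exists l; apply H; apply locally_ball.
- exact H.
Qed.

(** The identity comes with two convergence statements because [lim] and [CRInt_0_infty] are total
    operators, defined for divergent arguments as well. *)
Theorem theorem4 (tau : C) (htau : fundamental_region tau)
    (s : C) (hs : 2 < Re s) :
  filterlim (square_sum (lattice_term tau s)) eventually
    (locally (Etilde tau s)) /\
  ex_CRInt_0_infty (integrand tau s) /\
  Etilde tau s =
    (Ccos (PI / 2 * s) * (4 / CGamma s) * CRInt_0_infty (integrand tau s))%C.
Proof.
destruct htau as [Hre [Him _]].
assert (HG : CGamma s <> 0%C) by (apply CGamma_neq_0; lra).
(* The margin is [1 - |Re tau| >= 1/2] for the right sector. For the upper one it is [Im tau], since
   [Re (- i tau) = Im tau] and [Re i = 0]. *)
destruct (sector_integral 1 tau s (1 / 2)) as [l1 [I1 L1]]; [lra| |exact hs|].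
{ change (Re 1) with 1; assert (Rabs (Re tau) <= 1 / 2) by (apply Rabs_le; lra); lra. }
destruct (sector_integral (- (Ci * tau)) Ci s (Im tau)) as [l2 [I2 L2]];
  [exact Him| |exact hs|].
{ unfold Re, Im; simpl; rewrite Rabs_R0; lra. }
set (e1 := Cexp (- (Ci * PI * s))).
set (e2 := Cexp (- (Ci * (PI / 2)%R * s))).
set (e3 := Cexp (- (Ci * (- (PI / 2))%R * s))).
assert (I : is_CRInt_0_infty (integrand tau s) (e2 / 2 * l1 + / 2 * l2)%C).
{ apply is_CRInt_0_infty_ext with (2 := is_CRInt_0_infty_plus _ _ _ _
    (is_CRInt_0_infty_Cmult (e2 / 2) _ _ I1) (is_CRInt_0_infty_Cmult (/ 2) _ _ I2)).
  intros x _; symmetry; apply integrand_sectors. }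
set (L := (((1 + e1) * l1 + (e2 + e3) * l2) / CGamma s)%C).
assert (Lim : filterlim (square_sum (lattice_term tau s)) eventually
  (locally (T := C_R_CompleteNormedModule) L)).
{ apply filterlim_C_eps; intros eps He.
  set (a := Cmod (1 + e1)); set (b := Cmod (e2 + e3)); set (g := Cmod (CGamma s)).
  assert (Ha : 0 <= a) by apply Cmod_ge_0; assert (Hb : 0 <= b) by apply Cmod_ge_0.
  assert (Hg : 0 < g) by (apply Cmod_gt_0, HG).
  set (e := g * eps / (a + b + 1)).
  assert (Hpos : 0 < e) by (apply Rdiv_lt_0_compat; [apply Rmult_lt_0_compat|]; lra).
  destruct (L1 e Hpos) as [N1 H1]; destruct (L2 e Hpos) as [N2 H2].
  exists (Nat.max N1 N2); intros K HK.
  specialize (H1 K ltac:(lia)); specialize (H2 K ltac:(lia)).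
  rewrite square_sum_lattice by assumption; fold e1 e2 e3; unfold L.
  replace ((1 + e1) * sector_sum 1 tau s K + (e2 + e3) * sector_sum (- (Ci * tau)) Ci s K
     - ((1 + e1) * l1 + (e2 + e3) * l2) / CGamma s)%C
    with (((1 + e1) * (CGamma s * sector_sum 1 tau s K - l1)
       + (e2 + e3) * (CGamma s * sector_sum (- (Ci * tau)) Ci s K - l2)) / CGamma s)%C
    by (field; exact HG).
  unfold Cdiv; rewrite Cmod_mult, Cmod_inv by exact HG; fold g.
  apply Rmult_lt_reg_r with g; [exact Hg|].
  rewrite Rmult_assoc, Rinv_l, Rmult_1_r by lra.
  apply Rle_lt_trans with (1 := Cmod_triangle _ _); rewrite !Cmod_mult; fold a b.
  apply Rle_lt_trans with (a * e + b * e).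
  { apply Rplus_le_compat; apply Rmult_le_compat_l; lra. }
  apply Rlt_le_trans with ((a + b + 1) * e); [lra|].
  apply Req_le; unfold e; field; lra. }
assert (E : Etilde tau s = L) by (apply lim_unique_C, Lim).
split; [rewrite E; exact Lim|split; [eexists; exact I|]].
rewrite (is_CRInt_0_infty_unique _ _ I), E; unfold L.
assert (C : Ccos (PI / 2 * s) = ((e2 + e3) / 2)%C).
{ unfold Ccos, e2, e3; rewrite Cplus_comm.
  do 3 f_equal; rewrite ?RtoC_opp, RtoC_div by lra; field; apply C2_neq_0. }
(* With [e2 * e3 = 1] this gives [1 + e1 = e2 (e2 + e3)], so [e2 + e3 = 2 cos (PI s / 2)] is a
   common factor of the two sector contributions. *)
assert (E1 : e1 = (e2 * e2)%C).
{ unfold e1, e2; rewrite <- Cexp_plus; f_equal; rewrite RtoC_div by lra; field; apply C2_neq_0. }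
assert (E3 : (e2 * e3)%C = 1%C).
{ unfold e2, e3; rewrite <- Cexp_plus, <- Cexp_0; f_equal; rewrite RtoC_opp; ring. }
rewrite C, E1, <- E3; field; repeat split; first [exact HG|apply C2_neq_0].
Qed.
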